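(* Let $(\mathcal M,g)$ be a strongly indecomposable pp-wave with parallel null vector field $V$, such that each point of $\mathcal M$ admits a neighbourhood $\mathcal U$ with Killing vector fields defined on $\mathcal U$ that span the distribution $V^\perp|_{\mathcal U}$ (so these Killing vector fields are sections of $V^\perp|_{\mathcal U}$ and span $V^\perp|_q$ at every $q\in\mathcal U$). Then $(\mathcal M,g)$ is a plane wave.
   Context: $\nabla$ is the Levi-Civita connection of $g$, and $R(X,Y)=[\nabla_X,\nabla_Y]-\nabla_{[X,Y]}$ is its curvature, which via the metric is also regarded as the curvature endomorphism $R:\Lambda^2T\mathcal M\to\Lambda^2T\mathcal M$. A Lorentzian manifold $(\mathcal M,g)$ is a pp-wave if it admits a parallel null vector field $V$ (i.e. $V\neq 0$, $g(V,V)=0$, $\nabla V=0$) and if its curvature endomorphism is non-zero (not identically zero) and satisfies $R|_{V^\perp\wedge V^\perp}=0$, where $V^\perp=\{X\in T\mathcal M\mid g(X,V)=0\}$. A plane wave is a pp-wave satisfying in addition $\nabla_UR=0$ for all $U\in V^\perp$. $(\mathcal M,g)$ is strongly indecomposable if no point has a neighbourhood on which $g$ is a product metric (i.e. a semi-Riemannian product of two metrics on manifolds of positive dimension). *)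

(* Defs.v *)
From HB Require Import structures.
From mathcomp Require Import all_boot all_order all_algebra.
From mathcomp Require Import all_classical all_reals all_analysis.

Set Implicit Arguments.
Unset Strict Implicit.
Unset Printing Implicit Defensive.

Import Order.TTheory GRing.Theory Num.Theory.
Import numFieldNormedType.Exports.

Local Open Scope classical_set_scope.
Local Open Scope ring_scope.

Section Coordinates.
Context {R : realType}.

Definition basis_vec n (i : 'I_n) : 'rV[R]_n := delta_mx 0 i.

Definition iter_partial n (s : seq 'I_n) (f : 'rV[R]_n -> R) : 'rV[R]_n -> R :=
  foldr (fun i h => 'D_(basis_vec i) h) f s.

(* C^oo on the open set [W]: all iterated partial derivatives exist and are
   continuous at the points of [W]. *)
Definition smooth_on n (W : set 'rV[R]_n) (f : 'rV[R]_n -> R) : Prop :=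
  forall (s : seq 'I_n) (x : 'rV[R]_n), W x ->
    {for x, continuous (iter_partial s f)} /\
    (forall i, derivable (iter_partial s f) x (basis_vec i)).

Definition smooth_map n m (W : set 'rV[R]_n) (f : 'rV[R]_n -> 'rV[R]_m) : Prop :=
  forall j, smooth_on W (fun x => f x 0 j).

(* The scalar product of [u] and [v] with Gram matrix [G]. *)
Definition mdot n (G : 'M[R]_n) (u v : 'rV[R]_n) : R := (u *m G *m v^T) 0 0.

Definition semi_riemannian n (W : set 'rV[R]_n) (G : 'rV[R]_n -> 'M[R]_n) : Prop :=
  [/\ open W,
      forall i j, smooth_on W (fun x => G x i j) &
      forall x, W x -> (G x)^T = G x /\ G x \in unitmx].

Definition minkowski n : 'M[R]_n :=
  diag_mx (\row_(j < n) if (j == 0 :> nat) then -1 else 1).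

(* [G] represents a scalar product of signature (-,+,...,+). *)
Definition lorentz_form n (G : 'M[R]_n) : Prop :=
  exists2 P : 'M[R]_n, P \in unitmx & P *m G *m P^T = minkowski n.

Variable n : nat.
Local Notation vec := 'rV[R]_n.
Implicit Types (G : vec -> 'M[R]_n) (X Y Z : vec -> vec) (x u v w : vec).

(* The Christoffel symbol Gamma^k_(i j) of the metric [G]. *)
Definition christoffel G (k i j : 'I_n) x : R :=
  2^-1 * \sum_l invmx (G x) k l *
    ('D_(basis_vec i) (fun y => G y j l) x + 'D_(basis_vec j) (fun y => G y i l) x
     - 'D_(basis_vec l) (fun y => G y i j) x).

Definition levi_civita G X Y : vec -> vec := fun x =>
  'D_(X x) Y x +
  \row_k \sum_i \sum_j christoffel G k i j x * X x 0 i * Y x 0 j.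

Definition lie_bracket X Y : vec -> vec := fun x => 'D_(X x) Y x - 'D_(Y x) X x.

Definition curvature G X Y Z : vec -> vec := fun x =>
  levi_civita G X (levi_civita G Y Z) x - levi_civita G Y (levi_civita G X Z) x
  - levi_civita G (lie_bracket X Y) Z x.

Definition nabla_curvature G U X Y Z : vec -> vec := fun x =>
  levi_civita G U (curvature G X Y Z) x
  - curvature G (levi_civita G U X) Y Z x
  - curvature G X (levi_civita G U Y) Z x
  - curvature G X Y (levi_civita G U Z) x.

(* The derivative of [G] along the flow of [K], on the fields [X] and [Y]. *)
Definition lie_metric G K X Y : vec -> R := fun x =>
  'D_(K x) (fun y => mdot (G y) (X y) (Y y)) x
  - mdot (G x) (lie_bracket K X x) (Y x) - mdot (G x) (X x) (lie_bracket K Y x).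

(* [curvature], [nabla_curvature] and [lie_metric] are tensorial in the fields
   other than [K], so their values on tangent vectors at [x] can be computed by
   extending these vectors to fields with constant coefficients. *)
Definition riem G x u v w : vec := curvature G (cst u) (cst v) (cst w) x.

Definition nabla_riem G x s u v w : vec :=
  nabla_curvature G (cst s) (cst u) (cst v) (cst w) x.

Definition killing_on (W : set vec) G K : Prop :=
  forall x, W x -> forall u v, lie_metric G K (cst u) (cst v) x = 0.

(* Bivectors are represented by antisymmetric matrices of contravariant
   components. *)
Definition wedge u v : 'M[R]_n := u^T *m v - v^T *m u.

(* The linear operator on bivectors such that
   g(Riem (u /\ v), z /\ w) = g(R(u, v) z, w), where
   g(a /\ b, z /\ w) = g(a, z) g(b, w) - g(a, w) g(b, z). *)
Definition curvature_endo G x (B : 'M[R]_n) : 'M[R]_n :=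
  2^-1 *: \sum_i \sum_j B i j *:
    (invmx (G x) *m
     \matrix_(m, k) riem G x (basis_vec i) (basis_vec j) (basis_vec m) 0 k).

End Coordinates.

Record chart (R : realType) (n : nat) (T : topologicalType) := Chart {
  cdom : set T;
  cmap : T -> 'rV[R]_n;
  cinv : 'rV[R]_n -> T;
  cdom_open : open cdom;
  crange_open : open (cmap @` cdom);
  cmapK : forall p, cdom p -> cinv (cmap p) = p;
  cmap_continuous : forall p, cdom p -> {for p, continuous cmap};
  cinv_continuous : forall x, (cmap @` cdom) x -> {for x, continuous cinv} }.

Section Charts.
Context {R : realType} {n : nat} {T : topologicalType}.
Implicit Types c d : chart R n T.

(* The part of the range of [c] that represents [U]. *)
Definition cimage c (U : set T) : set 'rV[R]_n := cmap c @` (cdom c `&` U).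

Definition transition c d : 'rV[R]_n -> 'rV[R]_n := cmap d \o cinv c.

Definition compatible c d : Prop :=
  smooth_map (cimage c (cdom d)) (transition c d) /\
  smooth_map (cimage d (cdom c)) (transition d c).

End Charts.

Record manifold (R : realType) (n : nat) := Manifold {
  carrier :> topologicalType;
  carrier_hausdorff : hausdorff_space carrier;
  carrier_second_countable : @second_countable carrier;
  atlas : set (chart R n carrier);
  atlas_cover : forall p : carrier, exists2 c, atlas c & cdom c p;
  atlas_compatible : forall c d, atlas c -> atlas d -> compatible c d;
  atlas_maximal : forall c, (forall d, atlas d -> compatible c d) -> atlas c }.

Section Manifolds.
Context {R : realType} {n : nat}.
Variable M : manifold R n.

(* Tensor fields are given by their components in the charts of the atlas, as
   functions of the coordinates; the predicates below impose the transformation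
   laws under changes of charts.  Components at points outside the range of the
   chart are irrelevant. *)
Definition vfield := chart R n M -> 'rV[R]_n -> 'rV[R]_n.
Definition bilinear_field := chart R n M -> 'rV[R]_n -> 'M[R]_n.

Definition vector_field_on (U : set M) (X : vfield) : Prop :=
  (forall c, atlas c -> smooth_map (cimage c U) (X c)) /\
  (forall c d x, atlas c -> atlas d -> cimage c (cdom d `&` U) x ->
     X d (transition c d x) = 'D_(X c x) (transition c d) x).

Definition lorentzian_metric (g : bilinear_field) : Prop :=
  [/\ forall c, atlas c -> semi_riemannian (cimage c setT) (g c),
      forall c x, atlas c -> cimage c setT x -> lorentz_form (g c x) &
      forall c d x u v, atlas c -> atlas d -> cimage c (cdom d) x ->
        mdot (g d (transition c d x))
          ('D_u (transition c d) x) ('D_v (transition c d) x)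
        = mdot (g c x) u v].

(* [p] has a neighbourhood, the domain of a chart with range [W1] x [W2], on
   which [g] is the product of the metrics [h1] on [W1] and [h2] on [W2].  Since
   the factors of a product can be shrunk to coordinate neighbourhoods, this
   covers products of arbitrary semi-Riemannian manifolds. *)
Definition product_near (g : bilinear_field) (p : M) : Prop :=
  exists (c : chart R n M) (n1 n2 : nat) (e : (n1 + n2)%N = n)
    (W1 : set 'rV[R]_n1) (W2 : set 'rV[R]_n2)
    (h1 : 'rV[R]_n1 -> 'M[R]_n1) (h2 : 'rV[R]_n2 -> 'M[R]_n2),
  [/\ atlas c /\ cdom c p,
      (0 < n1)%N /\ (0 < n2)%N,
      semi_riemannian W1 h1 /\ semi_riemannian W2 h2,
      cimage c setT =
        [set castmx (erefl 1%N, e) (row_mx y.1 y.2) | y in W1 `*` W2] &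
      forall y1 y2, W1 y1 -> W2 y2 ->
        g c (castmx (erefl 1%N, e) (row_mx y1 y2)) =
        castmx (e, e) (block_mx (h1 y1) 0 0 (h2 y2))].

Definition strongly_indecomposable (g : bilinear_field) : Prop :=
  forall p : M, ~ product_near g p.

Definition parallel_null_field (g : bilinear_field) (V : vfield) : Prop :=
  vector_field_on setT V /\
  forall c x, atlas c -> cimage c setT x ->
    [/\ V c x != 0,
        mdot (g c x) (V c x) (V c x) = 0 &
        forall u, levi_civita (g c) (cst u) (V c) x = 0].

(* [mdot (g c x) u (V c x) = 0] says that [u] lies in the hyperplane orthogonal
   to V, whose exterior square is spanned by the bivectors [wedge u v]. *)
Definition pp_wave (g : bilinear_field) (V : vfield) : Prop :=
  [/\ parallel_null_field g V,
      exists c x (B : 'M[R]_n),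
        [/\ atlas c, cimage c setT x, B^T = - B & curvature_endo (g c) x B != 0] &
      forall c x u v, atlas c -> cimage c setT x ->
        mdot (g c x) u (V c x) = 0 -> mdot (g c x) v (V c x) = 0 ->
        curvature_endo (g c) x (wedge u v) = 0].

Definition plane_wave (g : bilinear_field) (V : vfield) : Prop :=
  pp_wave g V /\
  forall c x s, atlas c -> cimage c setT x -> mdot (g c x) s (V c x) = 0 ->
    forall u v w, nabla_riem (g c) x s u v w = 0.

Definition killing_field_on (g : bilinear_field) (U : set M) (K : vfield) : Prop :=
  vector_field_on U K /\ forall c, atlas c -> killing_on (cimage c U) (g c) (K c).

(* At each point of [U], the linear span of the values of the members of [S] is
   the orthogonal of V. *)
Definition spans_orthogonal (g : bilinear_field) (V : vfield) (U : set M)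
    (S : set vfield) : Prop :=
  forall c x w, atlas c -> cimage c U x ->
    mdot (g c x) w (V c x) = 0 <->
    exists (m : nat) (K : 'I_m -> vfield),
      (forall i, S (K i)) /\ (w <= \matrix_(i < m) K i c x)%MS.

End Manifolds.

(* Main.v *)
(** For a Killing field [K] that is a section of the orthogonal V^perp of V, put
    A_K X = nabla_X K.  Then A_K is skew, A_[K,L] = [A_L, A_K] + R(K, L) with
    R(K, L) = 0, and invariance of the curvature reads nabla_K R = A_K . R.

    At a point, choose N with g(N, V) = 1.  The curvature of a pp-wave amounts
    to the symmetric form S(x, y) = g(R(x, N) N, y) on the Euclidean space
    V^perp / V.  For an orthonormal basis (f_k) of this space and Killing fields
    with K_k = f_k at the point, the derivatives of S are T_k = [a_k, S], where
    a_k is the skew matrix induced by A_(K_k).  By the second Bianchi identity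
    T_kij is totally symmetric.  The relation T = [a, S] for the Killing field
    [K_k, K_l] says that
      F_lk = [a_l, T_k] - sum_m (a_l)_mk T_m
    is symmetric in k and l, hence F_lkij is totally symmetric.  Since the
    matrices F_lk are traceless, sum_k F_kk = 0, and therefore
      sum_k tr (T_k^2) = - tr (S sum_k [a_k, T_k])
                       = - sum_(k,m) (a_k)_mk tr (S [a_m, S]) = 0.
    So every T_k vanishes, and with it nabla_U R for U in V^perp. *)

Require Import Defs.
From HB Require Import structures.
From mathcomp Require Import all_boot all_order all_algebra.
From mathcomp Require Import ring lra.

Set Implicit Arguments.
Unset Strict Implicit.
Unset Printing Implicit Defensive.

Import Order.TTheory GRing.Theory Num.Theory.

Local Open Scope ring_scope.

(** * Koszul algebra: curvature and Killing fields *)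

(** The identities involve derivatives of the metric up to the third order, and checking smoothness
    at each commutation would swamp the argument. The smooth functions on a coordinate domain are
    therefore made into a ring with commuting derivations, over which connection, curvature and the
    Killing equation are pure algebra. Evaluations at points are jointly injective ring morphisms
    and bring the results down to tangent vectors.

    At a point only the 1-jets (K, A_K) survive. T is never differentiated: the jets are closed
    under brackets, and [K_k, K_l] supplies the relation that a derivative of T would give. The
    value of K does not determine A_K, but it determines A_K . R, which equals nabla_K R; hence T is
    linear in the direction. As V is parallel, A_K maps into V^perp, where the curvature vanishes on
    pairs.

    No basis of V^perp / V is chosen. The vectors [f k], as many as M has dimensions, form a
    Parseval frame of it: the expansion u = c V + sum_k g(u, f_k) f_k suffices for the matrix
    identities of an orthonormal basis. *)

(** The bracket of fields is not part of the data: it is the commutator of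
    [nabla], so that torsion-freeness is built in. *)
Record koszul (F : comPzRingType) (n : nat) := Koszul {
  act : 'rV[F]_n -> F -> F;
  nabla : 'rV[F]_n -> 'rV[F]_n -> 'rV[F]_n;
  metric : 'rV[F]_n -> 'rV[F]_n -> F;
  actD : forall X a b, act X (a + b) = act X a + act X b;
  actM : forall X a b, act X (a * b) = act X a * b + a * act X b;
  nablaD : forall X Y Z, nabla X (Y + Z) = nabla X Y + nabla X Z;
  nablaM : forall a X Y, nabla X (a *: Y) = act X a *: Y + a *: nabla X Y;
  nabla_lin : forall a X Y Z, nabla (a *: X + Y) Z = a *: nabla X Z + nabla Y Z;
  act_bracket : forall X Y a,
    act (nabla X Y - nabla Y X) a = act X (act Y a) - act Y (act X a);
  bracket_jacobi : forall X Y Z, let bracket U W := nabla U W - nabla W U in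
    bracket X (bracket Y Z) + bracket Y (bracket Z X) + bracket Z (bracket X Y)
      = 0;
  metric_lin : forall a X Y Z, metric (a *: X + Y) Z =
    a * metric X Z + metric Y Z;
  metricC : forall X Y, metric X Y = metric Y X;
  act_metric : forall X Y Z, act X (metric Y Z) =
    metric (nabla X Y) Z + metric Y (nabla X Z);
  metric_nondeg : forall X, (forall Y, metric X Y = 0) -> X = 0;
  no2tor : forall a : F, a + a = 0 -> a = 0 }.

(** Lets [ring] work modulo a known equation: it remains to exhibit [a - b] as the difference of the
    two sides of that equation. *)
Lemma eq_of_sub (A : zmodType) (a b p q : A) : p = q -> a - b = p - q -> a = b.
Proof. by move=> -> /eqP; rewrite subrr subr_eq0 => /eqP. Qed.

Ltac rowring := apply/rowP => ?; rewrite !mxE; ring.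

Section Koszul.
Context (F : comPzRingType) (n : nat) (C : koszul F n).
Implicit Types (a b : F) (K L U X Y Z W : 'rV[F]_n).
Local Notation D := (nabla C).
Local Notation g := (metric C).

Lemma nablaDl X Y Z : D (X + Y) Z = D X Z + D Y Z.
Proof. by rewrite -[X]scale1r nabla_lin !scale1r. Qed.

Lemma nabla0l Z : D 0 Z = 0.
Proof. by apply: (addrI (D 0 Z)); rewrite -nablaDl !addr0. Qed.

Lemma nablaZl a X Z : D (a *: X) Z = a *: D X Z.
Proof. by rewrite -[a *: X]addr0 nabla_lin nabla0l addr0. Qed.

Lemma nablaNl X Z : D (- X) Z = - D X Z.
Proof. by rewrite -scaleN1r nablaZl scaleN1r. Qed.

Lemma nablaBl X Y Z : D (X - Y) Z = D X Z - D Y Z.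
Proof. by rewrite nablaDl nablaNl. Qed.

Lemma nabla0 X : D X 0 = 0.
Proof. by apply: (addrI (D X 0)); rewrite -nablaD !addr0. Qed.

Lemma nablaN X Y : D X (- Y) = - D X Y.
Proof. by apply: (addrI (D X Y)); rewrite -nablaD !subrr nabla0. Qed.

Lemma nablaB X Y Z : D X (Y - Z) = D X Y - D X Z.
Proof. by rewrite nablaD nablaN. Qed.

Lemma act0 X : act C X 0 = 0.
Proof. by apply: (addrI (act C X 0)); rewrite -actD !addr0. Qed.

Lemma metricDl X Y Z : g (X + Y) Z = g X Z + g Y Z.
Proof. by rewrite -[X]scale1r metric_lin !scale1r mul1r. Qed.

Lemma metric0l Z : g 0 Z = 0.
Proof. by apply: (addrI (g 0 Z)); rewrite -metricDl !addr0. Qed.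

Lemma metricZl a X Z : g (a *: X) Z = a * g X Z.
Proof. by rewrite -[a *: X]addr0 metric_lin metric0l addr0. Qed.

Lemma metricNl X Z : g (- X) Z = - g X Z.
Proof. by rewrite -scaleN1r metricZl mulN1r. Qed.

Lemma metricBl X Y Z : g (X - Y) Z = g X Z - g Y Z.
Proof. by rewrite metricDl metricNl. Qed.

Lemma metricDr X Y Z : g X (Y + Z) = g X Y + g X Z.
Proof. by rewrite metricC metricDl !(metricC C X). Qed.

Lemma metricNr X Y : g X (- Y) = - g X Y.
Proof. by rewrite metricC metricNl metricC. Qed.

Lemma metricBr X Y Z : g X (Y - Z) = g X Y - g X Z.
Proof. by rewrite metricDr metricNr. Qed.

Lemma metric0r X : g X 0 = 0.
Proof. by rewrite metricC metric0l. Qed.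

Lemma metric_eq X Y : (forall Z, g X Z = g Y Z) -> X = Y.
Proof.
move=> e; apply/eqP; rewrite -subr_eq0; apply/eqP;
  apply: (metric_nondeg (k := C)) => Z.
by rewrite metricBl e subrr.
Qed.

Definition bracket X Y := D X Y - D Y X.

Lemma nabla_br X Y Z : D (bracket X Y) Z = D (D X Y) Z - D (D Y X) Z.
Proof. exact: nablaBl. Qed.

Definition curv X Y Z := D X (D Y Z) - D Y (D X Z) - D (bracket X Y) Z.

Lemma curvC X Y Z : curv X Y Z = - curv Y X Z.
Proof. rewrite /curv !nabla_br; rowring. Qed.

(** Since the bracket is the commutator of [nabla], the cyclic sum is the Jacobi identity written
    out. *)
Lemma curv_bianchi1 X Y Z : curv X Y Z + curv Y Z X + curv Z X Y = 0.
Proof.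
have := bracket_jacobi C X Y Z; rewrite /= !nablaB !nablaBl => e.
rewrite -{}[RHS]e /curv !nabla_br; rowring.
Qed.

(** Metric compatibility, applied twice to the function [g Z W], is compared with the action of the
    bracket on this function. *)
Lemma curv_skew X Y Z W : g (curv X Y Z) W = - g Z (curv X Y W).
Proof.
have := act_bracket C X Y (g Z W); rewrite -/(bracket X Y) !(act_metric, actD)
  => /esym e.
by apply: (eq_of_sub e); rewrite /curv !(metricBl, metricBr); ring.
Qed.

Lemma curv_pair X Y Z W : g (curv X Y Z) W = g (curv Z W X) Y.
Proof.
apply/eqP; rewrite -subr_eq0; apply/eqP; apply: (no2tor C).
have b x y z w : g (curv x y z) w + g (curv y z x) w + g (curv z x y) w = 0.
  by rewrite -!metricDl curv_bianchi1 metric0l.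
have s x y z w : g (curv x y z) w = - g (curv x y w) z by rewrite curv_skew
  metricC.
have c x y z w : g (curv x y z) w = - g (curv y x z) w by rewrite curvC
  metricNl.
(* The octahedron argument: of four first Bianchi identities two are added and two subtracted. The
   skew symmetries leave twice the wanted difference, whence the appeal to [no2tor]. *)
have e : (g (curv X Y Z) W + g (curv Y Z X) W + g (curv Z X Y) W) +
  (g (curv Y Z W) X + g (curv Z W Y) X + g (curv W Y Z) X) -
  (g (curv Z W X) Y + g (curv W X Z) Y + g (curv X Z W) Y) -
  (g (curv W X Y) Z + g (curv X Y W) Z + g (curv Y W X) Z) = 0.
  by rewrite !b !subr0 addr0.
apply: (eq_of_sub e).
rewrite (s Y Z W) (s Z W Y) (s X Y W) (s W X Z) (c X Z W) (s Z X W) (c Y W X)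
  (s W Y X).
by ring.
Qed.

Definition nabla_curv U X Y Z :=
  D U (curv X Y Z) - curv (D U X) Y Z - curv X (D U Y) Z - curv X Y (D U Z).

Lemma curvDl X Y Z W : curv (X + Y) Z W = curv X Z W + curv Y Z W.
Proof. by rewrite /curv /bracket !(nablaBl, nablaDl, nablaB, nablaD);
  rowring. Qed.

Lemma curvNl X Z W : curv (- X) Z W = - curv X Z W.
Proof. by rewrite /curv /bracket !(nablaBl, nablaNl, nablaN, nablaB);
  rowring. Qed.

Lemma curvBl X Y Z W : curv (X - Y) Z W = curv X Z W - curv Y Z W.
Proof. by rewrite curvDl curvNl. Qed.

Lemma curvDr X Y Z W : curv X Y (Z + W) = curv X Y Z + curv X Y W.
Proof. by rewrite /curv /bracket !nablaD; rowring. Qed.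

Lemma curvDm X Y Z W : curv X (Y + Z) W = curv X Y W + curv X Z W.
Proof. by rewrite curvC curvDl opprD -!(curvC X). Qed.

Lemma curvZl a X Y Z : curv (a *: X) Y Z = a *: curv X Y Z.
Proof.
by rewrite /curv /bracket !(nablaM, nablaBl, nablaZl, nablaDl); rowring.
Qed.

Lemma curvZm a X Y Z : curv X (a *: Y) Z = a *: curv X Y Z.
Proof. by rewrite curvC curvZl -scalerN -curvC. Qed.

Lemma curvZr a X Y Z : curv X Y (a *: Z) = a *: curv X Y Z.
Proof.
have := act_bracket C X Y a; rewrite -/(bracket X Y) /curv !(nablaM, nablaD) =>
  ->.
by rowring.
Qed.

(** This is the Jacobi identity for the operators [D U], [D X], [D Y] acting on [Z]. By
    torsion-freeness the correction terms of [nabla_curv] pair up into curvatures of brackets. *)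
Lemma nabla_curv_bianchi2 U X Y Z : nabla_curv U X Y Z + nabla_curv X Y U Z +
  nabla_curv Y U X Z = 0.
Proof.
rewrite /nabla_curv.
have t A B W : curv (bracket A B) W Z = curv (D A B) W Z - curv (D B A) W Z by
  exact: curvBl.
rewrite (curvC Y (D X U)) (curvC U (D Y X)) (curvC X (D U Y)).
(* When these curvatures are expanded, the derivatives along iterated brackets cancel by Jacobi. *)
have J : curv (bracket U X) Y Z + curv (bracket X Y) U Z + curv (bracket Y U) X
  Z =
  D (bracket U X) (D Y Z) - D Y (D (bracket U X) Z) + (D (bracket X Y) (D U Z)
   - D U (D (bracket X Y) Z)) + (D (bracket Y U) (D X Z) - D X (D (bracket Y U)
     Z)).
  have := bracket_jacobi C U X Y; rewrite /= -/(bracket _ _) => J.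
  rewrite /curv.
  have e : D (bracket (bracket U X) Y) Z + D (bracket (bracket X Y) U) Z + D
    (bracket (bracket Y U) X) Z = 0.
    rewrite -!nablaDl -[RHS](nabla0l Z) -[in RHS]oppr0 -[in RHS]J;
      congr (D _ Z).
    by rewrite /bracket; rowring.
  apply: (eq_of_sub (esym e)); rowring.
rewrite !t in J; apply: (eq_of_sub (esym J)).
have u A B W : curv A B W = D A (D B W) - D B (D A W) - D (bracket A B) W by [].
rewrite (u X Y Z) (u Y U Z) (u U X Z) !(u _ _ (D _ Z)) !nablaB; rowring.
Qed.

Definition killing K := forall X Y, g (D X K) Y + g X (D Y K) = 0.

Lemma killing_lie K X Y :
  act C K (g X Y) - g (bracket K X) Y - g X (bracket K Y) =
    g (D X K) Y + g X (D Y K).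
Proof. by rewrite act_metric /bracket metricBl metricBr; ring. Qed.

Lemma killing_skew K X Y : killing K -> g (D X K) Y = - g X (D Y K).
Proof. by move=> h; apply/eqP; rewrite -addr_eq0 h. Qed.

(** Kostant's identity: the second covariant derivative of a Killing field is a curvature term, so
    that 1-jets suffice later. The defect [E] dies by the same symmetry argument as in the
    uniqueness of the Levi-Civita connection. *)
Lemma kostant K X Y : killing K -> D X (D Y K) - D (D X Y) K = curv X K Y.
Proof.
move=> kK; apply: metric_eq => Z.
pose H X Y := D X (D Y K) - D (D X Y) K.
pose E X Y Z := g (H X Y - curv X K Y) Z.
(* [E] is symmetric in its first two and skew in its last two arguments. *)
have E12 A B c : E A B c = E B A c.
  have e : H A B - H B A = curv A B K by rewrite /H /curv /bracket nablaBl;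
    rowring.
  have b := curv_bianchi1 A B K.
  rewrite /E; congr (g _ c); apply: (eq_of_sub b).
  apply: (eq_of_sub e); rewrite (curvC A K) ; rowring.
have E23 A B c : E A B c = - E A c B.
  have e : g (H A B) c = - g (H A c) B.
    have h : act C A (g (D B K) c + g B (D c K)) = 0 by rewrite kK act0.
    rewrite actD !act_metric in h.
    have k1 := killing_skew B (D A c) kK; have k2 := killing_skew c (D A B) kK.
    rewrite k1 (metricC C (D A B)) k2 in h.
    by apply: (eq_of_sub h); rewrite /H !metricBl !(metricC C _ B) !(metricC C
      _ c); ring.
  by rewrite /E metricBl (metricBl (H A c)) e curv_skew (metricC C B); ring.
have : E X Y Z + E X Y Z = 0.
  have e : E X Y Z = - E X Y Z.
    (* Six transpositions, three of which change the sign, restore the order of the arguments. *)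
    by rewrite {1}E23 E12 E23 E12 E23 E12 !opprK.
  by rewrite {1}e addNr.
by move/(no2tor C) => /eqP; rewrite /E metricBl subr_eq0 => /eqP.
Qed.

(** Kostant's identity removes both second derivatives; the two curvature terms that it leaves
    combine by the first Bianchi identity. *)
Lemma nabla_br_killing K L X : killing K -> killing L ->
  D X (bracket K L) = D (D X K) L - D (D X L) K + curv K L X.
Proof.
move=> kK kL; have eK := kostant X L kK; have eL := kostant X K kL.
have b := curv_bianchi1 K L X.
rewrite /bracket nablaB.
rewrite -[D X (D K L)](subrK (D (D X K) L)) -[D X (D L K)](subrK (D (D X L) K)).
rewrite eK eL (curvC X L); apply: (eq_of_sub (esym b)).
by rowring.
Qed.

Lemma killing_br K L : killing K -> killing L -> killing (bracket K L).
Proof.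
move=> kK kL X Y; rewrite !nabla_br_killing//; have := curv_skew K L X Y.
move: (curv K L X) (curv K L Y) => P Q e; rewrite !(metricDl, metricDr,
  metricNl, metricNr) e.
have l := killing_skew _ _ kL; have k := killing_skew _ _ kK.
rewrite (l (D X K)) (k X (D Y L)) (k (D X L)) (l X (D Y K)); ring.
Qed.

Definition alg_act (A : 'rV[F]_n -> 'rV[F]_n) X Y Z :=
  A (curv X Y Z) - curv X Y (A Z) - curv (A X) Y Z - curv X (A Y) Z.

(** The flow of [K] preserves the connection, so [bracket K] is a derivation of the curvature; it
    differs from [D K] exactly by the endomorphism on the right. *)
Lemma nabla_curv_killing K X Y Z : killing K ->
  nabla_curv K X Y Z = alg_act (fun W => D W K) X Y Z.
Proof.
move=> kK; rewrite /nabla_curv /alg_act.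
have t A : D K A = D A K + bracket K A by rewrite /bracket addrC subrK.
(* Kostant's identity in its second guise: [bracket K] is a derivation of the connection. *)
have l A B : bracket K (D A B) = D (bracket K A) B + D A (bracket K B).
  have := kostant A B kK; rewrite /bracket => e.
  have c : curv K A B = D K (D A B) - D A (D K B) - D (D K A - D A K) B by [].
  rewrite (curvC A K) in e; rewrite nablaB.
  by apply: (eq_of_sub e); rewrite c; rowring.
have kB A B : bracket K (A - B) = bracket K A - bracket K B.
  by rewrite /bracket nablaB nablaBl; rowring.
have e : bracket K (curv X Y Z) =
    curv (bracket K X) Y Z + curv X (bracket K Y) Z + curv X Y (bracket K Z).
  have r A B W : D (bracket A B) W = D (D A B) W - D (D B A) W by exact:
    nablaBl.
  (* Only [l] and compatibility with differences matter from here on, so [bracket K] becomes an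
     arbitrary operation [k]. *)
  move: (bracket K) l kB => k l kB; rewrite {1}/curv !kB !l r kB !l /curv.
  rewrite (r (k X) Y) (r X (k Y)) (r X Y);
    rewrite !nablaD !nablaDl !nablaNl !nablaDl; rowring.
rewrite (t (curv X Y Z)) e (t X) (t Y) (t Z) !(curvDr, curvDl, curvDm).
rowring.
Qed.

Lemma nabla_curvC U X Y Z : nabla_curv U X Y Z = - nabla_curv U Y X Z.
Proof.
rewrite /nabla_curv (curvC X Y) (curvC (D U X)) (curvC X (D U Y)) (curvC X Y (D
  U Z)) nablaN.
by rowring.
Qed.

(** In the second Bianchi identity for [K], [L], [N] the derivative along [N] of the vanishing
    [curv K L] drops out. This is the source of the symmetry of T; the last two hypotheses will hold
    because V is parallel. *)
Lemma alg_act_sym K L N Z : killing K -> killing L ->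
  (forall W, curv K L W = 0) -> (forall W, curv (D N K) L W = 0) ->
  (forall W, curv K (D N L) W = 0) ->
  alg_act (fun W => D W K) L N Z = alg_act (fun W => D W L) K N Z.
Proof.
move=> kK kL z z1 z2; rewrite -!nabla_curv_killing//.
have := nabla_curv_bianchi2 K L N Z.
rewrite [nabla_curv N K L Z]/nabla_curv !z z1 z2 nabla0 !subr0 addr0
  (nabla_curvC L N).
by move/eqP; rewrite subr_eq0 => /eqP.
Qed.

End Koszul.

(** * The Levi-Civita connection over a differential ring *)

Section DifferentialRing.
Context (F : comPzRingType) (n : nat) (d : 'I_n -> F -> F).
Context (g ginv : 'M[F]_n) (half : F).
Hypothesis dD : forall i a b, d i (a + b) = d i a + d i b.
Hypothesis dM : forall i a b, d i (a * b) = d i a * b + a * d i b.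
Hypothesis dC : forall i j a, d i (d j a) = d j (d i a).
Hypothesis gT : g^T = g.
Hypothesis gV : g *m ginv = 1%:M.
Hypothesis halfP : half + half = 1.
Implicit Types (X Y Z : 'rV[F]_n).

Definition dact X (a : F) : F := \sum_i X 0 i * d i a.

Definition gam k i j : F :=
  half * \sum_l ginv k l * (d i (g j l) + d j (g i l) - d l (g i j)).

(** The connection matrix along [X], laid out to act on row vectors from the right. *)
Definition gamx X : 'M[F]_n := \matrix_(j, k) \sum_i gam k i j * X 0 i.

Definition dnab X Y : 'rV[F]_n := map_mx (dact X) Y + Y *m gamx X.

Definition dgm X Y : F := (X *m g *m Y^T) 0 0.

Lemma d0 i : d i 0 = 0.
Proof. by apply: (addrI (d i 0)); rewrite -dD !addr0. Qed.

Lemma dactD X a b : dact X (a + b) = dact X a + dact X b.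
Proof. by rewrite /dact -big_split; apply: eq_bigr => i _;
  rewrite dD mulrDr. Qed.

Lemma dact0 X : dact X 0 = 0.
Proof. by rewrite /dact big1 // => i _; rewrite d0 mulr0. Qed.

Lemma dactN X a : dact X (- a) = - dact X a.
Proof. by apply: (addrI (dact X a)); rewrite -dactD !subrr dact0. Qed.

Lemma dactM X a b : dact X (a * b) = dact X a * b + a * dact X b.
Proof.
rewrite /dact mulr_suml mulr_sumr -big_split; apply: eq_bigr => i _ /=.
by rewrite dM; ring.
Qed.

Lemma dact_lin a X Y b : dact (a *: X + Y) b = a * dact X b + dact Y b.
Proof.
rewrite /dact mulr_sumr -big_split; apply: eq_bigr => i _ /=.
by rewrite !mxE; ring.
Qed.

Lemma dact_sum X (I : finType) (f : I -> F) :
  dact X (\sum_j f j) = \sum_j dact X (f j).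
Proof. by apply: big_morph; [exact: dactD | exact: dact0]. Qed.

Lemma map_dactM X p q r (A : 'M[F]_(p, q)) (B : 'M[F]_(q, r)) :
  map_mx (dact X) (A *m B) = map_mx (dact X) A *m B + A *m map_mx (dact X) B.
Proof.
apply/matrixP => i j; rewrite !mxE dact_sum -big_split.
by apply: eq_bigr => k _ /=; rewrite dactM !mxE.
Qed.

Lemma gamC k i j : gam k i j = gam k j i.
Proof.
rewrite /gam; congr (_ * _); apply: eq_bigr => l _.
have gE a b : g a b = g b a by rewrite -{1}gT mxE.
by rewrite (gE i j); ring.
Qed.

Lemma gamx_lin a X Y : gamx (a *: X + Y) = a *: gamx X + gamx Y.
Proof.
apply/matrixP => i j; rewrite !mxE mulr_sumr -big_split; apply: eq_bigr =>
  k _ /=.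
by rewrite !mxE; ring.
Qed.

Lemma gamx_sym X Y : Y *m gamx X = X *m gamx Y.
Proof.
apply/rowP => k; rewrite !mxE.
under eq_bigr => i _ do rewrite mxE mulr_sumr.
rewrite exchange_big; apply: eq_bigr => i _ /=; rewrite mxE mulr_sumr.
by apply: eq_bigr => j _; rewrite gamC; ring.
Qed.

Lemma dbrE X Y : dnab X Y - dnab Y X = map_mx (dact X) Y - map_mx (dact Y) X.
Proof. rewrite /dnab (gamx_sym X Y); rowring. Qed.

Lemma dact_br X Y a :
  dact (dnab X Y - dnab Y X) a = dact X (dact Y a) - dact Y (dact X a).
Proof.
rewrite dbrE.
(* The second-order part is symmetric in the two fields because the [d i] commute, so it cancels in
   the commutator. *)
have E U W : dact U (dact W a) = dact (map_mx (dact U) W) a +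
    \sum_i \sum_j U 0 i * W 0 j * d i (d j a).
  rewrite [dact W a]/dact dact_sum [X in _ + X]exchange_big -big_split.
  apply: eq_bigr => j _ /=.
  rewrite dactM mxE; congr (_ + _).
  by rewrite /dact mulr_sumr; apply: eq_bigr => i _; ring.
rewrite !E -[_ - map_mx _ _]addrC -scaleN1r dact_lin [in RHS]exchange_big /=.
under [X in _ + _ - (_ + X)]eq_bigr => i _ do
  under eq_bigr => j _ do rewrite dC [Y _ _ * _]mulrC.
ring.
Qed.

Lemma gam_low i j c : \sum_k gam k i j * g k c =
  half * (d i (g j c) + d j (g i c) - d c (g i j)).
Proof.
pose w : 'cV_n := \col_l (d i (g j l) + d j (g i l) - d l (g i j)).
have : (g *m (ginv *m w)) c 0 = w c 0 by rewrite mulmxA gV mul1mx.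
rewrite [RHS]mxE => <-; rewrite mxE mulr_sumr; apply: eq_bigr => k _.
have -> : g k c = g c k by rewrite -{1}gT mxE.
rewrite /gam -mulrA [_ * g c k]mulrC; congr (_ * (_ * _)); rewrite mxE.
by apply: eq_bigr => l _; rewrite mxE.
Qed.

(** In the lowered Christoffel symbols two of the three derivatives are skew in [b] and [c]. Adding
    the transpose cancels them and doubles the third, which [half] compensates. *)
Lemma dgm_compat X : map_mx (dact X) g = gamx X *m g + g *m (gamx X)^T.
Proof.
have gE a b : g a b = g b a by rewrite -{1}gT mxE.
have H b c : (gamx X *m g) b c = \sum_i
    X 0 i * (half * (d i (g b c) + d b (g i c) - d c (g i b))).
  rewrite mxE; under eq_bigr => k _ do rewrite mxE mulr_suml.
  rewrite exchange_big /=; apply: eq_bigr => i _.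
  by rewrite -gam_low mulr_sumr; apply: eq_bigr => k _; ring.
have -> : g *m (gamx X)^T = (gamx X *m g)^T by rewrite trmx_mul gT.
apply/matrixP => b c; rewrite [RHS]mxE [_^T _ _]mxE !H mxE /dact -big_split /=.
apply: eq_bigr => i _; rewrite (gE c b) (gE i b) (gE i c).
by rewrite -{1}[d i _]mul1r -halfP; ring.
Qed.

Lemma dact_gm X Y Z : dact X (dgm Y Z) = dgm (dnab X Y) Z + dgm Y (dnab X Z).
Proof.
have -> : dact X (dgm Y Z) = (map_mx (dact X) (Y *m g *m Z^T)) 0 0 by rewrite
  mxE.
rewrite !map_dactM dgm_compat /dgm /dnab -map_trmx.
rewrite !linearD /= trmx_mul !(mulmxDl, mulmxDr) !mulmxA.
by rewrite !mxE; ring.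
Qed.

Lemma dgm_lin a X Y Z : dgm (a *: X + Y) Z = a * dgm X Z + dgm Y Z.
Proof. by rewrite /dgm !mulmxDl -!scalemxAl !mxE. Qed.

Lemma dgmC X Y : dgm X Y = dgm Y X.
Proof.
rewrite /dgm -[in LHS](trmxK (X *m g *m Y^T)) mxE.
by rewrite !trmx_mul trmxK gT mulmxA.
Qed.

Lemma dnabD X Y Z : dnab X (Y + Z) = dnab X Y + dnab X Z.
Proof.
rewrite /dnab mulmxDl; apply/rowP => k; rewrite !mxE dactD; ring.
Qed.

Lemma dnabM a X Y : dnab X (a *: Y) = dact X a *: Y + a *: dnab X Y.
Proof.
rewrite /dnab -scalemxAl scalerDr addrA; congr (_ + _).
by apply/rowP => k; rewrite !mxE dactM.
Qed.

Lemma dnab_lin a X Y Z : dnab (a *: X + Y) Z = a *: dnab X Z + dnab Y Z.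
Proof.
rewrite /dnab gamx_lin mulmxDr -scalemxAr.
apply/rowP => k; rewrite !mxE dact_lin; ring.
Qed.

Lemma dbr_jacobi X Y Z : let bracket U W := dnab U W - dnab W U in
  bracket X (bracket Y Z) + bracket Y (bracket Z X) + bracket Z (bracket X Y) =
    0.
Proof.
move=> bracket.
have brE U W k : bracket U W 0 k = dact U (W 0 k) - dact W (U 0 k).
  by rewrite /bracket dbrE !mxE.
have H U W T k : bracket U (bracket W T) 0 k =
   dact U (dact W (T 0 k)) - dact U (dact T (W 0 k))
   - dact W (dact T (U 0 k)) + dact T (dact W (U 0 k)).
  by rewrite brE [bracket W T 0 k]brE dactD dactN dact_br; ring.
apply/rowP => k; rewrite [RHS]mxE [LHS]mxE [X in X + _]mxE !H.
by move: (dact X) (dact Y) (dact Z) => a b c; ring.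
Qed.

Lemma dgm_nondeg X : (forall Y, dgm X Y = 0) -> X = 0.
Proof.
move=> H; rewrite -[X]mulmx1 -gV mulmxA.
suff -> : X *m g = 0 by rewrite mul0mx.
apply/rowP => k; rewrite [RHS]mxE -[RHS](H (delta_mx 0 k)).
by rewrite /dgm trmx_delta -colE [RHS]mxE.
Qed.

Lemma d_no2tor (a : F) : a + a = 0 -> a = 0.
Proof. by move=> h; rewrite -[a]mul1r -halfP mulrDl -mulrDr h mulr0. Qed.

Definition coord_koszul : koszul F n :=
  Koszul dactD dactM dnabD dnabM dnab_lin dact_br dbr_jacobi
    dgm_lin dgmC dact_gm dgm_nondeg d_no2tor.

End DifferentialRing.

(** * Pointwise linear algebra *)

Section IsospectralCodazzi.
Context (R : realFieldType) (n : nat) (S : 'M[R]_n) (a T : 'I_n -> 'M[R]_n).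
Hypothesis Tdef : forall k, T k = a k *m S - S *m a k.
Hypothesis ST : S^T = S.
Hypothesis aT : forall k, (a k)^T = - a k.
Hypothesis Tsym : forall k i j, T k i j = T i k j.
Hypothesis Tbr : forall k l, \sum_m (a l m k - a k m l) *: T m =
  (a l *m a k - a k *m a l) *m S - S *m (a l *m a k - a k *m a l).

Let aE k i j : a k i j = - a k j i.
Proof. by have := congr1 (fun A : 'M[R]_n => A j i) (aT k); rewrite !mxE. Qed.

Let T_T k : (T k)^T = T k.
Proof.
by rewrite Tdef linearB /= !trmx_mul ST aT mulmxN mulNmx opprK addrC.
Qed.

Let TE k i j : T k i j = T k j i.
Proof. by rewrite -{1}T_T mxE. Qed.

(* The action of [a l] on the trilinear form T, with one argument fixed. *)
Let F l k := a l *m T k - T k *m a l - \sum_m a l m k *: T m.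

(** By Jacobi, [a_l, [a_k, S]] - [a_k, [a_l, S]] = [[a_l, a_k], S], and [Tbr] expands the right-hand
    side in the T_m. *)
Let F_swap l k : F l k = F k l.
Proof.
have := Tbr k l; under eq_bigr => m _ do rewrite scalerBl.
rewrite big_split sumrN /= => e.
apply/eqP; rewrite -subr_eq0; apply/eqP.
pose c := \sum_m a l m k *: T m - \sum_m a k m l *: T m.
have -> : F l k - F k l = (a l *m T k - T k *m a l) - (a k *m T l - T l *m a k)
  - c.
  by rewrite /F /c; apply/matrixP => i j; rewrite !mxE; ring.
rewrite /c e !Tdef !(mulmxBl, mulmxBr) !mulmxA.
by apply/matrixP => i j; rewrite !mxE; ring.
Qed.

(** Skewness of [a l] puts the three slots of T on the same footing: [F l] is a derivation applied
    to a totally symmetric form, and inherits the total symmetry. *)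
Let FE l k i j : F l k i j =
  \sum_p (a l i p * T k p j + a l j p * T k i p + a l k p * T p i j).
Proof.
rewrite /F !mxE summxE -!sumrB; apply: eq_bigr => p _.
by rewrite [X in _ - X]mxE (aE l p j) (aE l p k); ring.
Qed.

Let F_sym12 l k i j : F l k i j = F l i k j.
Proof.
rewrite !FE; apply: eq_bigr => p _.
by rewrite (Tsym k p j) (Tsym p i j) (Tsym k i p); ring.
Qed.

Let F_symm l k i j : F l k i j = F l k j i.
Proof.
rewrite !FE; apply: eq_bigr => p _.
by rewrite (TE k p j) (TE k i p) (TE p i j); ring.
Qed.

Let trB (A B : 'M[R]_n) : \tr (A - B) = \tr A - \tr B.
Proof. exact: raddfB. Qed.

Let tr_comm (A B : 'M[R]_n) : \tr (A *m B - B *m A) = 0.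
Proof. by rewrite trB mxtrace_mulC subrr. Qed.

Let trF l k : \tr (F l k) = 0.
Proof.
rewrite /F trB tr_comm sub0r [\tr _]raddf_sum big1 ?oppr0// => m _.
by rewrite /= linearZ /= Tdef tr_comm mulr0.
Qed.

Lemma isospectral_codazzi_parallel k : T k = 0.
Proof.
have Fkk : \sum_k F k k = 0.
  apply/matrixP => i j; rewrite summxE [RHS]mxE -[RHS](trF i j) /mxtrace.
  (* The repeated index moves from the first pair of slots to the last, which turns the contraction
     into the trace of [F i j]. *)
  by apply: eq_bigr => l _; rewrite F_sym12 F_swap F_symm F_sym12.
have e : \sum_k (a k *m T k - T k *m a k) = \sum_k \sum_m a k m k *: T m.
  by move: Fkk; rewrite /F sumrB => /eqP; rewrite subr_eq0 => /eqP.
have z : \sum_k \tr (T k *m T k) = 0.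
  have E l : \tr (T l *m T l) = - \tr (S *m (a l *m T l - T l *m a l)).
    rewrite {1}Tdef mulmxBl mulmxBr !trB opprB !mulmxA; congr (_ - _).
    by rewrite -[a l *m S *m _]mulmxA mxtrace_mulC.
  under eq_bigr => l _ do rewrite E.
  rewrite sumrN -raddf_sum /= -mulmx_sumr e mulmx_sumr [\tr _]raddf_sum /=.
  rewrite big1 ?oppr0// => l _.
  rewrite mulmx_sumr [\tr _]raddf_sum big1// => m _.
  rewrite /= -scalemxAr linearZ /= Tdef mulmxBr trB mulmxA.
  by rewrite [X in X - _]mxtrace_mulC mulmxA subrr mulr0.
(* As [T l] is symmetric, the trace of its square is a sum of squares; here the ordering of the
   field enters. *)
have tT l : \tr (T l *m T l) = \sum_i \sum_j T l i j ^+ 2.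
  by apply: eq_bigr => i _; rewrite mxE; apply: eq_bigr => j _;
    rewrite (TE l j i) expr2.
have pos l i : 0 <= \sum_j T l i j ^+ 2 by apply: sumr_ge0 => j _;
  exact: sqr_ge0.
have z1 : \tr (T k *m T k) = 0.
  move/eqP: z; rewrite psumr_eq0 => [/allP/(_ k)/(_ (mem_index_enum k))/eqP//|l
    _].
  by rewrite tT; apply: sumr_ge0.
apply/matrixP => i j; rewrite [RHS]mxE.
move: z1; rewrite tT => /eqP; rewrite psumr_eq0 //.
move=> /allP/(_ i)/(_ (mem_index_enum i)) /=.
rewrite psumr_eq0 => [|l _]; last exact: sqr_ge0.
by move=> /allP/(_ j)/(_ (mem_index_enum j)); rewrite sqrf_eq0 => /eqP.
Qed.

End IsospectralCodazzi.

Section CurvatureLike.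
Context (R : fieldType) (n : nat).
Local Notation vec := 'rV[R]_n.
Context (perp : vec -> Prop) (N : vec) (al : vec -> R).
Hypothesis split_perp : forall x, perp (x - al x *: N).
Variable q : vec -> vec -> vec -> vec -> R.
Hypothesis ql : forall a x x' y z w,
  q (a *: x + x') y z w = a * q x y z w + q x' y z w.
Hypothesis qC : forall x y z w, q x y z w = - q y x z w.
Hypothesis qalt : forall x z w, q x x z w = 0.
Hypothesis qpair : forall x y z w, q x y z w = q z w x y.
Hypothesis qperp : forall x y z w, perp x -> perp y -> q x y z w = 0.
Hypothesis qN : forall x y, perp x -> perp y -> q x N N y = 0.

(** Each argument splits into a multiple of [N] and a vector of [perp]. Two vectors of [perp] in one
    pair give zero, and pair symmetry leaves only the values [q x N N y]. *)
Lemma curvature_like_eq0 x y z w : q x y z w = 0.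
Proof.
have dec u : exists2 u', perp u' & exists a, u = a *: N + u'.
  by exists (u - al u *: N); [exact: split_perp | exists (al u);
    rewrite addrC subrK].
(* A skew form need only be tested on [perp] against [perp] and against [N]; this serves for the
   first pair of arguments and then for the second. *)
have red (P : vec -> vec -> R) : (forall a x x' y, P (a *: x + x') y =
  a * P x y + P x' y) ->
    (forall x y, P x y = - P y x) -> (forall x, P x x = 0) ->
    (forall x y, perp x -> perp y -> P x y = 0) ->
    (forall x, perp x -> P x N = 0) -> forall x y, P x y = 0.
  move=> Pl PC Palt Pp PN u v.
  have [u' pu [a ->]] := dec u; have [v' pv [c ->]] := dec v.
  by rewrite Pl (PC N) (PC u') !Pl Palt (PC N u') (Pp v' u')// !PN//; ring.
apply: (red (fun x y => q x y z w)) => //=; first by move=> *; exact: qperp.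
move=> u pu; rewrite qpair.
apply: (red (fun z w => q z w u N)) => //=; first by move=> *; exact: qperp.
by move=> v pv; rewrite qpair qC qpair qN// oppr0.
Qed.

End CurvatureLike.

(** * Curvature and jets of Killing fields at one point *)

Section Pointwise.
Context (R : realFieldType) (n : nat).
Local Notation vec := 'rV[R]_n.
Implicit Types (u v w x y z : vec) (A B : 'M[R]_n).
Context (b : vec -> vec -> R) (V N : vec) (f : 'I_n -> vec).
Context (Rm : vec -> vec -> vec -> vec).
(* [kp u A]: some Killing field orthogonal to V has value [u] and covariant
   derivative [A] at the given point. *)
Context (kp : vec -> 'M[R]_n -> Prop).
Hypothesis b_lin : forall a x x' y, b (a *: x + x') y = a * b x y + b x' y.
Hypothesis bC : forall x y, b x y = b y x.
Hypothesis b_nondeg : forall x, (forall y, b x y = 0) -> x = 0.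
Hypothesis bNV : b N V = 1.
Hypothesis bVV : b V V = 0.
Hypothesis f_perp : forall k, b (f k) V = 0.
Hypothesis frame : forall u, b u V = 0 ->
  exists c, u = c *: V + \sum_k b u (f k) *: f k.
Hypothesis Rm_lin1 : forall a x x' y z,
  Rm (a *: x + x') y z = a *: Rm x y z + Rm x' y z.
Hypothesis RmC : forall x y z, Rm x y z = - Rm y x z.
Hypothesis Rm_skew : forall x y z w, b (Rm x y z) w = - b z (Rm x y w).
Hypothesis Rm_pair : forall x y z w, b (Rm x y z) w = b (Rm z w x) y.
Hypothesis RmV : forall x y, Rm x y V = 0.
Hypothesis Rm_perp : forall x y z, b x V = 0 -> b y V = 0 -> Rm x y z = 0.

(** The derivative of [Rm] under the action of [A] as an infinitesimal
    endomorphism. *)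
Definition mx_act A x y z : vec :=
  Rm x y z *m A - Rm x y (z *m A) - Rm (x *m A) y z - Rm x (y *m A) z.

Hypothesis kp_lin : forall a u v A B, kp u A -> kp v B ->
  kp (a *: u + v) (a *: A + B).
Hypothesis kp_br : forall u v A B, kp u A -> kp v B ->
  kp (u *m B - v *m A) (A *m B - B *m A).
Hypothesis kp_V : kp V 0.
Hypothesis kp_perp : forall u A, kp u A -> b u V = 0.
Hypothesis kp_skew : forall u A x y, kp u A -> b (x *m A) y = - b x (y *m A).
Hypothesis kp_im : forall u A x, kp u A -> b (x *m A) V = 0.
Hypothesis kp_ex : forall u, b u V = 0 -> exists A, kp u A.
Hypothesis kp_sym : forall u v A B w z, kp u A -> kp v B ->
  mx_act A v w z = mx_act B u w z.
Hypothesis kp_0 : forall A x y z, kp 0 A -> mx_act A x y z = 0.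

Let b0l y : b 0 y = 0.
Proof. by apply: (addrI (1 * b 0 y)); rewrite -b_lin scaler0 !addr0 mul1r. Qed.
Let bDl x x' y : b (x + x') y = b x y + b x' y.
Proof. by rewrite -[x]scale1r b_lin mul1r scale1r. Qed.
Let bZl a x y : b (a *: x) y = a * b x y.
Proof. by rewrite -[a *: x]addr0 b_lin b0l addr0. Qed.
Let bNl x y : b (- x) y = - b x y.
Proof. by rewrite -scaleN1r bZl mulN1r. Qed.
Let bDr x y y' : b x (y + y') = b x y + b x y'.
Proof. by rewrite !(bC x) bDl. Qed.
Let bZr a x y : b x (a *: y) = a * b x y.
Proof. by rewrite !(bC x) bZl. Qed.
Let b0r x : b x 0 = 0. Proof. by rewrite bC b0l. Qed.
Let b_suml (I : finType) (F : I -> vec) y : b (\sum_i F i) y = \sum_i b (F i) y.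
Proof. by apply: (big_morph (b ^~ y)) => [x x'|];
  [exact: bDl | exact: b0l]. Qed.
Let b_eq x y : (forall z, b x z = b y z) -> x = y.
Proof.
move=> e; apply/eqP; rewrite -subr_eq0; apply/eqP/b_nondeg => z.
by rewrite bDl bNl e subrr.
Qed.

Let kp_AV u A : kp u A -> V *m A = 0.
Proof.
by move=> k; apply: b_nondeg => y; rewrite (kp_skew _ _ k) bC (kp_im _ k) oppr0.
Qed.

Let rm x y z w := b (Rm x y z) w.
Let rml a x x' y z w : rm (a *: x + x') y z w = a * rm x y z w + rm x' y z w.
Proof. by rewrite /rm Rm_lin1 b_lin. Qed.
Let rmC x y z w : rm x y z w = - rm y x z w.
Proof. by rewrite /rm RmC bNl. Qed.
Let rm_pair x y z w : rm x y z w = rm z w x y.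
Proof. exact: Rm_pair. Qed.
Let rm_perp x y z w : b x V = 0 -> b y V = 0 -> rm x y z w = 0.
Proof. by move=> px py; rewrite /rm Rm_perp// b0l. Qed.

Let dm A x y z w := b (mx_act A x y z) w.
Let dmE u A x y z w : kp u A -> dm A x y z w =
  - (rm (x *m A) y z w + rm x (y *m A) z w + rm x y (z *m A) w + rm x y z (w *m
    A)).
Proof.
move=> k; rewrite /dm /mx_act !bDl !bNl (kp_skew _ _ k) /rm; ring.
Qed.

Let rho x y := rm x N N y.
Let rhoC x y : rho x y = rho y x.
Proof. by rewrite /rho rm_pair rmC rm_pair rmC opprK. Qed.
Let rho_lin a x x' y : rho (a *: x + x') y = a * rho x y + rho x' y.
Proof. exact: rml. Qed.
Let rhoV y : rho V y = 0.
Proof. by rewrite rhoC /rho /rm Rm_skew RmV b0r oppr0. Qed.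
Let rho0 y : rho 0 y = 0.
Proof. by apply: (addrI (1 * rho 0 y)); rewrite -rho_lin scaler0 !addr0 mul1r.
  Qed.
Let rhoD x x' y : rho (x + x') y = rho x y + rho x' y.
Proof. by rewrite -[x]scale1r rho_lin mul1r scale1r. Qed.
Let rhoZ a x y : rho (a *: x) y = a * rho x y.
Proof. by rewrite -[a *: x]addr0 rho_lin rho0 addr0. Qed.

Let rho_frame u y : b u V = 0 -> rho u y = \sum_k b u (f k) * rho (f k) y.
Proof.
move=> /frame[c {1}->]; rewrite rho_lin rhoV mulr0 add0r.
rewrite (big_morph (rho ^~ y) (id1 := 0) (op1 := +%R)) => [|x x'|];
  last 2 first.
- exact: rhoD.
- exact: rho0.
by apply: eq_bigr => k _; rewrite rhoZ.
Qed.

Let tau A x y := dm A x N N y.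
(** The terms in which [A] acts on [N] vanish: [N *m A] is orthogonal to [V], so it forms with [x],
    or after pair symmetry with [y], a pair on which the curvature is zero. *)
Let tauE u A x y : kp u A -> b x V = 0 -> b y V = 0 ->
  tau A x y = - (rho (x *m A) y + rho x (y *m A)).
Proof.
move=> k px py; have pN := kp_im N k.
rewrite /tau (dmE _ _ _ _ k) /rho (rm_perp _ _ px pN).
by rewrite [rm x N (N *m A) y]rm_pair (rm_perp _ _ pN py); ring.
Qed.

(** Frame coefficients in column form, whereas [A] acts on rows. Products are thus reversed, as the
    formula A_[K,L] = [A_L, A_K] requires. *)
Let am A : 'M[R]_n := \matrix_(i, j) b (f j *m A) (f i).
Let SM : 'M[R]_n := \matrix_(i, j) rho (f i) (f j).
Let tm A : 'M[R]_n := \matrix_(i, j) tau A (f i) (f j).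

Let am_skew u A : kp u A -> (am A)^T = - am A.
Proof.
by move=> k; apply/matrixP => i j; rewrite !mxE (kp_skew _ _ k) bC.
Qed.

Let tm_comm u A : kp u A -> tm A = am A *m SM - SM *m am A.
Proof.
move=> k; apply/matrixP => i j; rewrite mxE (tauE k)// (rhoC (f i)).
rewrite !rho_frame ?(kp_im _ k)// !mxE opprD -!sumrN -!big_split /=.
apply: eq_bigr => m _; rewrite !mxE (kp_skew (f i) _ k) (bC (f i)) (rhoC (f m)
  (f i)).
by ring.
Qed.

Let SM_T : SM^T = SM.
Proof. by apply/matrixP => i j; rewrite !mxE rhoC. Qed.

(** The frame expansion of [f j *m A] has a component along [V], but [B] annihilates it. *)
Let am_mul u v A B : kp u A -> kp v B -> am (A *m B) = am B *m am A.
Proof.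
move=> ku kv; apply/matrixP => i j; rewrite !mxE mulmxA.
have [c e] := frame (kp_im (f j) ku).
rewrite {1}e mulmxDl -scalemxAl (kp_AV kv) scaler0 add0r mulmx_suml b_suml.
by apply: eq_bigr => m _; rewrite -scalemxAl bZl !mxE mulrC.
Qed.

Let amB A B : am (A - B) = am A - am B.
Proof. by apply/matrixP => i j; rewrite !mxE mulmxBr bDl bNl. Qed.

Let mx_act_lin a A B x y z :
  mx_act (a *: A + B) x y z = a *: mx_act A x y z + mx_act B x y z.
Proof.
apply: b_eq => w; rewrite b_lin.
have rs x' y' z' w' : b (Rm x' y' z') w' = rm x' y' z' w' by [].
(* Linearity of [Rm] is assumed in the first argument only, so the symmetries bring the arguments
   moved by [C] to the first or the last slot of [rm]. *)
have E C : b (mx_act C x y z) w = b (Rm x y z *m C) w + rm x y w (z *m C)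
     - rm (x *m C) y z w + rm (y *m C) x z w.
  rewrite /mx_act !bDl !bNl !rs [rm x y (z *m C) w]rm_pair [rm x y w _]rm_pair.
  rewrite [rm (z *m C) w _ _]rmC [rm x (y *m C) _ _]rmC; ring.
have rml4 x1 x2 x3 (a' : R) y1 y2 :
   rm x1 x2 x3 (a' *: y1 + y2) = a' * rm x1 x2 x3 y1 + rm x1 x2 x3 y2.
  by rewrite /rm bDr bZr.
rewrite !E !mulmxDr -!scalemxAr b_lin !rml !rml4; ring.
Qed.

Let dm_lin u A a x x' y z w : kp u A ->
  dm A (a *: x + x') y z w = a * dm A x y z w + dm A x' y z w.
Proof.
by move=> k; rewrite !(dmE _ _ _ _ k) mulmxDl -scalemxAl !rml; ring.
Qed.

Let dmC u A x y z w : kp u A -> dm A x y z w = - dm A y x z w.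
Proof.
move=> k; rewrite !(dmE _ _ _ _ k) (rmC (y *m A)) (rmC y (x *m A)).
by rewrite (rmC y x (z *m A)) (rmC y x z); ring.
Qed.

Let dm_pair u A x y z w : kp u A -> dm A x y z w = dm A z w x y.
Proof.
move=> k; rewrite !(dmE _ _ _ _ k) (rm_pair (z *m A)) (rm_pair z (w *m A)).
by rewrite (rm_pair z w (x *m A)) (rm_pair z w x); ring.
Qed.

Let dm_perp u A x y z w : kp u A -> b x V = 0 -> b y V = 0 -> dm A x y z w = 0.
Proof.
move=> k px py; have ix := kp_im x k; have iy := kp_im y k.
by rewrite (dmE _ _ _ _ k) !rm_perp// !addr0 oppr0.
Qed.

Let tauC u A x y : kp u A -> b x V = 0 -> b y V = 0 -> tau A x y = tau A y x.
Proof.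
move=> k px py; rewrite !(tauE k)// (rhoC (x *m A)) (rhoC x).
by rewrite [in RHS]addrC.
Qed.

Let tau_frame u A x y : kp u A -> b x V = 0 -> b y V = 0 ->
  (forall i, tau A (f i) y = 0) -> tau A x y = 0.
Proof.
move=> k px py h; have [c ->] := frame px.
have tl a z z' : tau A (a *: z + z') y = a * tau A z y + tau A z' y.
  exact: (dm_lin _ _ _ _ _ _ k).
have t0 : tau A 0 y = 0.
  by apply: (addrI (1 * tau A 0 y)); rewrite -tl scaler0 !addr0 mul1r.
rewrite tl (tauE k)// (kp_AV k) rho0 rhoV addr0 oppr0 mulr0 add0r.
rewrite (big_morph (tau A ^~ y) (id1 := 0) (op1 := +%R)) => [|z z'|//];
  last first.
  by rewrite -[z in LHS]scale1r tl mul1r.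
by rewrite big1// => i _; rewrite -[_ *: _]addr0 tl t0 h mulr0 addr0.
Qed.

(** [dm A] inherits the symmetries of the curvature, and also its vanishing on pairs orthogonal to
    [V], because [A] maps into V^perp. Such a form is determined by [tau A], hence by its values on
    the frame. *)
Let mx_act_tm u A x y z : kp u A -> tm A = 0 -> mx_act A x y z = 0.
Proof.
move=> k t0; apply: b_nondeg => w; rewrite -/(dm A x y z w).
apply: (@curvature_like_eq0 _ _ (fun x => b x V = 0) N (b ^~ V)) => //.
- by move=> x'; rewrite bDl bNl bZl bNV mulr1 subrr.
- by move=> *; exact: dm_lin k.
- by move=> *; exact: dmC k.
- by move=> x' z' w'; have := dmC x' x' z' w' k; lra.
- by move=> *; exact: dm_pair k.
- by move=> *; exact: dm_perp k _ _.
- move=> x' y' px py; rewrite -/(tau A x' y').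
  have tij i j : tau A (f i) (f j) = 0.
    by have := congr1 (fun M : 'M[R]_n => M i j) t0; rewrite !mxE.
  apply: (tau_frame k px py) => i; rewrite (tauC k)//.
  by apply: (tau_frame k py) => // j; rewrite (tauC k).
Qed.

Lemma mx_act_eq0 u A x y z : kp u A -> mx_act A x y z = 0.
Proof.
have /fin_all_exists[Af kf] : forall k, exists A, kp (f k) A by move=> k;
  exact: kp_ex.
have kp0 : kp 0 0.
  by have := kp_lin (-1) kp_V kp_V; rewrite scaleN1r addNr scaleN1r addNr.
have kp_sum (c : 'I_n -> R) : kp (\sum_k c k *: f k) (\sum_k c k *: Af k).
  elim/big_ind2: _ => [//|u1 A1 u2 A2 k1 k2|k _].
    by have := kp_lin 1 k1 k2; rewrite !scale1r.
  by have := kp_lin (c k) (kf k) kp0; rewrite !addr0.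
have act0 x' y' z' : mx_act 0 x' y' z' = 0 by exact: kp_0.
have act_sum (c : 'I_n -> R) x' y' z' : mx_act (\sum_k c k *: Af k) x' y' z' =
    \sum_k c k *: mx_act (Af k) x' y' z'.
  rewrite (big_morph (fun A => mx_act A x' y' z') (id1 := 0) (op1 := +%R))//.
    by apply: eq_bigr => k _; rewrite -[_ *: Af k]addr0 mx_act_lin act0 addr0.
  by move=> B C; rewrite -[B in LHS]scale1r mx_act_lin scale1r.
(* A jet with value [v] and the combination of the frame jets and [V] with the same value differ by
   a jet with value 0, to which [kp_0] applies. *)
have comb v B x' y' z' : kp v B ->
    mx_act B x' y' z' = \sum_k b v (f k) *: mx_act (Af k) x' y' z'.
  move=> k; have [c e] := frame (kp_perp k).
  have := kp_lin c kp_V (kp_sum (fun m => b v (f m)));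
    rewrite -e scaler0 add0r => k'.
  have := kp_lin (-1) k' k; rewrite scaleN1r addNr => /(kp_0 x' y' z').
  rewrite mx_act_lin scaleN1r act_sum => /eqP; rewrite addrC subr_eq0 => /eqP.
  exact.
move=> k; rewrite (comb _ _ _ _ _ k) big1// => m _.
rewrite (mx_act_tm _ _ _ (kf m)) ?scaler0//.
apply: (@isospectral_codazzi_parallel _ _ SM (am \o Af) (tm \o Af)) => //=.
- by move=> i; exact: tm_comm (kf i).
- by move=> i; exact: am_skew (kf i).
- by move=> i j l; rewrite !mxE /tau /dm (kp_sym _ _ (kf i) (kf j)).
(* The bracket has the value [f i *m Af l - f l *m Af i], whose frame coefficients are the
   differences of matrix entries in [Tbr]. *)
- move=> i l; have kk := kp_br (kf i) (kf l).
  have := tm_comm kk; rewrite amB (am_mul (kf i) (kf l)) (am_mul (kf l) (kf i))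
    => <-.
  apply/matrixP => p q; rewrite summxE [RHS]mxE /tau /dm (comb _ _ _ _ _ kk)
    b_suml.
  apply: eq_bigr => r _; rewrite bZl !mxE /tau /dm; congr (_ * _).
  by rewrite bDl bNl.
Qed.

End Pointwise.

From mathcomp Require Import all_classical all_reals all_analysis.
Import numFieldNormedType.Exports.

Local Open Scope classical_set_scope.
Local Open Scope ring_scope.

(** * Scalar products and the screen of a null vector *)

Section ScalarProduct.
Context (R : realType) (n : nat) (G : 'M[R]_n).
Implicit Types (x y z : 'rV[R]_n).
Local Notation b := (mdot G).

Lemma mdot_lin a x x' y : b (a *: x + x') y = a * b x y + b x' y.
Proof. by rewrite /mdot !mulmxDl -!scalemxAl !mxE. Qed.

Lemma mdot_nondeg : G \in unitmx -> forall x, (forall y, b x y = 0) -> x = 0.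
Proof.
move=> Gu x H; rewrite -[x]mulmx1 -(mulmxV Gu) mulmxA.
suff -> : x *m G = 0 by rewrite mul0mx.
apply/rowP => k; rewrite [RHS]mxE -[RHS](H (delta_mx 0 k)).
by rewrite /mdot trmx_delta -colE [RHS]mxE.
Qed.

End ScalarProduct.

(** Modulo V, the nonzero-index vectors have the Gram matrix of the standard basis projected onto
    the hyperplane orthogonal to the spatial part of V. They are one too many for a basis, but a
    projected orthonormal basis is a Parseval frame, and this gives the expansion. *)
Lemma lorentz_screen (R : realType) (n : nat) (G : 'M[R]_n) (V : 'rV[R]_n) :
  lorentz_form G -> V != 0 -> mdot G V V = 0 ->
  exists f : 'I_n -> 'rV[R]_n, (forall k, mdot G (f k) V = 0) /\
    forall u, mdot G u V = 0 ->
      exists c, u = c *: V + \sum_k mdot G u (f k) *: f k.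
Proof.
case: n G V => [|n] G V [P Pu PG]; first by rewrite (thinmx0 V) eqxx.
move=> V0 VV.
have [v vP] : exists v, V = v *m P by exists (V *m invmx P); rewrite mulmxKV.
have bP x y : mdot G (x *m P) (y *m P) =
    - (x 0 0 * y 0 0) + \sum_(k < n) x 0 (lift ord0 k) * y 0 (lift ord0 k).
  rewrite /mdot trmx_mul !mulmxA -[x *m P *m G]mulmxA -[x *m (P *m G) *m
    P^T]mulmxA.
  rewrite PG mxE big_ord_recl /minkowski mul_mx_diag !mxE /= mulrN1 mulNr.
  by congr (_ + _); apply: eq_bigr => k _; rewrite !mxE /= mulr1.
have vv : \sum_(k < n) v 0 (lift ord0 k) * v 0 (lift ord0 k) = v 0 0 * v 0 0.
  by move: VV; rewrite vP bP => /eqP; rewrite addrC subr_eq0 => /eqP.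
(* A null vector without timelike component has a spacelike part of length zero. *)
have v0 : v 0 0 != 0.
  apply: contraNneq V0 => v00; rewrite vP.
  suff -> : v = 0 by rewrite mul0mx.
  move: vv; rewrite v00 mul0r => /eqP.
  rewrite psumr_eq0 => [/allP vk|k _]; last by rewrite -expr2 sqr_ge0.
  apply/rowP => k; rewrite [RHS]mxE; have [j ->|->] := unliftP ord0 k;
    last exact: v00.
  by have := vk j (mem_index_enum j); rewrite /= mulf_eq0 orbb => /eqP.
(* An orthonormal frame, with its spacelike vectors made orthogonal to V by
   adding a multiple of the timelike one. *)
pose e (k : 'I_n) : 'rV[R]_n.+1 :=
  delta_mx 0 (lift ord0 k) + (v 0 (lift ord0 k) / v 0 0) *: delta_mx 0 0.
(* The zero vector at index 0 pads the family to the index type of the coordinates and changes no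
   expansion. *)
pose f (k : 'I_n.+1) := if unlift ord0 k is Some j then e j *m P else 0.
have fl k : f (lift ord0 k) = e k *m P by rewrite /f liftK.
have f0 : f 0 = 0 by rewrite /f unlift_none.
have e0 k : e k 0 0 = v 0 (lift ord0 k) / v 0 0.
  by rewrite !mxE eqxx /= mulr1 add0r.
have ek k j : e k 0 (lift ord0 j) = (j == k)%:R.
  by rewrite !mxE eqxx (inj_eq lift_inj) /= mulr0 addr0.
have be x k : mdot G (x *m P) (f (lift ord0 k)) =
    x 0 (lift ord0 k) - x 0 0 * (v 0 (lift ord0 k) / v 0 0).
  rewrite fl bP e0 addrC; congr (_ - _).
  rewrite (bigD1 k)//= ek eqxx mulr1 big1 ?addr0// => j jk.
  by rewrite ek (negbTE jk) mulr0.
exists f; split.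
  move=> k; have [j ->|->] := unliftP ord0 k.
    rewrite fl vP bP e0 (bigD1 j)//= ek eqxx mul1r big1 => [|i ij].
      by rewrite addr0 divfK// addNr.
    by rewrite ek (negbTE ij) mul0r.
  by rewrite f0 /mdot !mul0mx mxE.
move=> u; have [x ->] : exists x, u = x *m P.
  by exists (u *m invmx P); rewrite mulmxKV.
rewrite {1}vP bP => /eqP; rewrite addrC subr_eq0 => /eqP xv.
(* With this coefficient the spacelike components agree; the timelike one then follows from [xv] and
   [vv]. *)
exists (x 0 0 / v 0 0); rewrite big_ord_recl f0 scaler0 add0r.
under eq_bigr => k _ do rewrite be fl scalemxAl.
rewrite -mulmx_suml {1}vP scalemxAl -mulmxDl; congr (_ *m _).
apply/rowP => k; rewrite !mxE summxE; have [j ->|->] := unliftP ord0 k.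
  rewrite (bigD1 j)//= [(_ *: e j) 0 _]mxE ek eqxx big1 => [|i ij].
    by rewrite mulr1 addr0; field.
  by rewrite mxE ek eq_sym (negbTE ij) mulr0.
under eq_bigr => i _ do rewrite mxE e0.
have -> : \sum_i (x 0 (lift ord0 i) - x 0 0 * (v 0 (lift ord0 i) / v 0 0)) *
    (v 0 (lift ord0 i) / v 0 0) =
  (\sum_i x 0 (lift ord0 i) * v 0 (lift ord0 i)) / v 0 0
  - x 0 0 / v 0 0 ^+ 2 * \sum_i v 0 (lift ord0 i) * v 0 (lift ord0 i).
  by rewrite mulr_suml mulr_sumr -sumrB; apply: eq_bigr => i _; field.
rewrite xv vv -[ord0]/(0 : 'I_n.+1); by field.
Qed.

(** * Directional derivatives and smooth functions *)

Section DirectionalDerivatives.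
Context {R : realType} {V : normedModType R}.
Implicit Types (f : V -> R) (x y u v w : V) (a s t : R).

Lemma line_quotient f x v t a :
  (fun h => h^-1 *: (((fun s => f (s *: v + x)) \o shift t) (h *: a)
                     - f (t *: v + x))) =
  (fun h => h^-1 *: ((f \o shift (t *: v + x)) (h *: (a *: v))
                     - f (t *: v + x))).
Proof. by apply/funext => h /=; rewrite scalerDl -!scalerA addrA. Qed.

Lemma derivable_line f x v t a :
  derivable (fun s => f (s *: v + x)) t a = derivable f (t *: v + x) (a *: v).
Proof. by rewrite /derivable line_quotient. Qed.

Lemma derive_line f x v t a :
  'D_a (fun s => f (s *: v + x)) t = 'D_(a *: v) f (t *: v + x).
Proof. by rewrite /derive line_quotient. Qed.

Lemma is_derive_scale_dir f x v a :
  derivable f x v -> is_derive x (a *: v) f (a * 'D_v f x).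
Proof.
move=> fxv.
have x0 : 0 *: v + x = x by rewrite scale0r add0r.
have d1 : derivable (fun s => f (s *: v + x)) 0 1.
  by rewrite derivable_line x0 scale1r.
have df : differentiable (fun s => f (s *: v + x)) 0 by apply/derivable1_diffP.
have e : 'D_a (fun s => f (s *: v + x)) 0 = a * 'D_1 (fun s =>
  f (s *: v + x)) 0.
  by rewrite !deriveE// -{1}[a]mulr1 -[a * 1]/(a *: 1) linearZ.
split.
  have : derivable (fun s => f (s *: v + x)) 0 a by exact: diff_derivable.
  by rewrite derivable_line x0.
by move: e; rewrite !derive_line !x0 scale1r.
Qed.

Lemma mvt_line f x v : (forall t, 0 <= t <= 1 -> derivable f (t *: v + x) v) ->
  exists2 t, 0 <= t <= 1 & f (v + x) - f x = 'D_v f (t *: v + x).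
Proof.
move=> fd.
have d t : 0 <= t <= 1 -> derivable (fun s => f (s *: v + x)) t 1.
  by move=> t01; rewrite derivable_line scale1r; apply: fd.
have [t t01 e] := @MVT_segment R (fun s => f (s *: v + x))
    (fun t => 'D_1 (fun s => f (s *: v + x)) t) 0 1 ler01
    (fun t t01 => derivableP (d t (subset_itv_oo_cc t01)))
    (derivable_within_continuous (i := `[0, 1]) (fun t t01 => d t t01)).
exists t; first by rewrite in_itv/= in t01.
by move: e; rewrite scale1r scale0r add0r subr0 mulr1 derive_line scale1r.
Qed.

(** Directional derivatives need not add up, so one of them is assumed continuous. The increment
    splits into a step along [u] and a step along [w]; the mean value theorem turns the latter into
    ['D_w f] at a point near [x]. *)
Lemma is_derive_add_dir f x u w : derivable f x u ->
  (\forall y \near x, derivable f y w) ->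
  {for x, continuous ('D_w f)} ->
  is_derive x (u + w) f ('D_u f x + 'D_w f x).
Proof.
move=> fu fw cw.
suff H : h^-1 *: ((f \o shift x) (h *: (u + w)) - f x) @[h --> 0^'] -->
    'D_u f x + 'D_w f x.
  by split; [apply/cvg_ex; eexists; exact: H | exact: cvg_lim H].
have -> : (fun h => h^-1 *: ((f \o shift x) (h *: (u + w)) - f x)) =
   (fun h => h^-1 *: ((f \o shift x) (h *: u) - f x) +
             h^-1 *: (f (h *: w + (h *: u + x)) - f (h *: u + x))).
  apply/funext => h /=; rewrite -scalerDr; congr (_ *: _).
  have -> : h *: (u + w) + x = h *: w + (h *: u + x).
    by rewrite scalerDr addrA [h *: w + _]addrC.
  by ring.
apply: cvgD; first exact: fu.
apply/cvgrPdist_le => e e0.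
have /nbhs_ballP[r r0 rP] : \forall y \near x, derivable f y w /\
    `|'D_w f x - 'D_w f y| <= e.
  near=> y; split; near: y => //.
  by move/cvgrPdist_le : cw; apply.
(* The added 1 keeps the denominator positive when both vectors vanish. *)
have M0 : 0 < `|u| + `|w| + 1 by rewrite ltr_wpDl// addr_ge0.
have P h t : `|h| < r / (`|u| + `|w| + 1) -> 0 <= t <= 1 ->
    ball x r (t *: (h *: w) + (h *: u + x)).
  move=> hr /andP[t0 t1]; rewrite -ball_normE /ball_/=.
  rewrite addrA opprD addrCA subrr addr0 normrN.
  rewrite ltr_pdivlMr// in hr; apply: le_lt_trans hr.
  rewrite (le_trans (ler_normD _ _))// !normrZ (ger0_norm t0).
  have := normr_ge0 w; have := normr_ge0 u; have := normr_ge0 h.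
  move=> h0 u0 w0.
  rewrite mulrDr mulr1 mulrDr; have : t * (`|h| * `|w|) <= `|h| * `|w|.
    by rewrite ler_piMl// mulr_ge0.
  by lra.
near=> h.
have h0 : h != 0 by near: h; exact: nbhs_dnbhs_neq.
have hr : `|h| < r / (`|u| + `|w| + 1).
  by near: h; apply: dnbhs0_lt; rewrite divr_gt0.
have [t t01 ->] : exists2 t, 0 <= t <= 1 &
   f (h *: w + (h *: u + x)) - f (h *: u + x) =
   'D_(h *: w) f (t *: (h *: w) + (h *: u + x)).
  apply: mvt_line => t t01.
  by have [d _] := rP _ (P _ _ hr t01); have [] := is_derive_scale_dir h d.
have [d dle] := rP _ (P _ _ hr t01).
have [_ ->] := is_derive_scale_dir h d.
by rewrite -[_ *: _]/(_ * _) mulrA mulVf// mul1r.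
Unshelve. all: by end_near. Qed.

Lemma mvt_dir f x v s :
  (forall t, 0 <= t <= 1 -> derivable f ((t * s) *: v + x) v) ->
  exists2 t, 0 <= t <= 1 &
    f (s *: v + x) - f x = s * 'D_v f ((t * s) *: v + x).
Proof.
move=> d.
have d' t : 0 <= t <= 1 -> derivable f (t *: (s *: v) + x) (s *: v).
  by move=> /d/(is_derive_scale_dir s)[+ _]; rewrite scalerA.
have [t t01 e] := mvt_line d'; exists t => //; rewrite e scalerA.
by have [_ ->] := is_derive_scale_dir s (d t t01).
Qed.

Lemma is_derive_translate f c y w : derivable f (c + y) w ->
  is_derive y w (fun z => f (c + z)) ('D_w f (c + y)).
Proof.
have E : (fun h => h^-1 *: (((fun z => f (c + z)) \o shift y) (h *: w)
     - f (c + y))) =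
   (fun h => h^-1 *: ((f \o shift (c + y)) (h *: w) - f (c + y))).
  by apply/funext => h /=; rewrite addrCA.
by move=> d; split; rewrite /derivable /derive E.
Qed.

(** The mean value theorem is used along [u] for the increment of [f] by [s *: v], then along [v]
    for ['D_u f]. *)
Lemma second_difference f x u v s :
  (forall a b, 0 <= a <= s -> 0 <= b <= s ->
    derivable f (b *: v + (a *: u + x)) u /\
    derivable ('D_u f) (b *: v + (a *: u + x)) v) -> 0 <= s ->
  exists a b, [/\ 0 <= a <= s, 0 <= b <= s &
    f (s *: v + (s *: u + x)) - f (s *: u + x) - (f (s *: v + x) - f x) =
    s ^+ 2 * 'D_v ('D_u f) (b *: v + (a *: u + x))].
Proof.
move=> fd s0.
have ts t : 0 <= t <= 1 -> 0 <= t * s <= s.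
  by move=> /andP[t0 t1]; rewrite mulr_ge0//= ler_piMl.
have ss : 0 <= s <= s by rewrite s0 lexx.
have s00 : 0 <= (0 : R) <= s by rewrite s0 lexx.
pose p y := f (s *: v + y) - f y.
have pd a : 0 <= a <= s -> is_derive (a *: u + x) u p
    ('D_u f (s *: v + (a *: u + x)) - 'D_u f (a *: u + x)).
  move=> a_s; apply: is_deriveB.
    exact: (is_derive_translate (fd a s a_s ss).1).
  apply: derivableP.
  by have := (fd a 0 a_s s00).1; rewrite scale0r add0r.
have [t t01 e] := mvt_dir (f := p) (x := x) (v := u)
  (fun t t01 => let: DeriveDef d _ := pd _ (ts t t01) in d).
have [_ E] := pd _ (ts t t01); rewrite {}E in e.
have fd' b : 0 <= b <= 1 -> derivable ('D_u f) ((b * s) *: v + ((t * s) *: u +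
  x)) v.
  by move=> b01; exact: (fd _ _ (ts t t01) (ts b b01)).2.
have [b b01 e'] := mvt_dir fd'.
exists (t * s), (b * s); split; [exact: ts | exact: ts |].
rewrite {}e' in e; rewrite expr2 -mulrA -e; reflexivity.
Qed.

(** Schwarz's theorem: one second difference over a small parallelogram is [s ^+ 2] times either
    mixed derivative at an intermediate point, and by continuity both values are close to those at
    [x]. *)
Lemma derive_comm f x u v :
  (\forall y \near x, [/\ derivable f y u, derivable f y v,
     derivable ('D_u f) y v & derivable ('D_v f) y u]) ->
  {for x, continuous ('D_v ('D_u f))} -> {for x, continuous ('D_u ('D_v f))} ->
  'D_v ('D_u f) x = 'D_u ('D_v f) x.
Proof.
move=> fd cu cv; apply/eqP; rewrite -subr_eq0 -normr_le0.
apply/ler_addgt0Pr => e e0; rewrite add0r.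
have /nbhs_ballP[r r0 rP] : \forall y \near x, [/\ derivable f y u,
     derivable f y v, derivable ('D_u f) y v & derivable ('D_v f) y u] /\
    (`|'D_v ('D_u f) x - 'D_v ('D_u f) y| <= e / 2 /\
     `|'D_u ('D_v f) x - 'D_u ('D_v f) y| <= e / 2).
  have e2 : 0 < e / 2 by rewrite divr_gt0.
  have cu' : \forall y \near x, `|'D_v ('D_u f) x - 'D_v ('D_u f) y| <= e / 2.
    by move/cvgrPdist_le : cu; apply.
  have cv' : \forall y \near x, `|'D_u ('D_v f) x - 'D_u ('D_v f) y| <= e / 2.
    by move/cvgrPdist_le : cv; apply.
  exact: (filterI fd (filterI cu' cv')).
have M0 : 0 < `|u| + `|v| + 1 by rewrite ltr_wpDl// addr_ge0.
(* Sides this short keep the parallelogram in the ball where both mixed derivatives are within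
   [e / 2] of their values at [x]. *)
pose s := r / 2 / (`|u| + `|v| + 1).
have s0 : 0 < s by rewrite !divr_gt0.
have P a b w z : `|w| + `|z| = `|u| + `|v| -> 0 <= a <= s -> 0 <= b <= s ->
    ball x r (b *: w + (a *: z + x)).
  move=> wz /andP[a0 a1] /andP[b0 b1]; rewrite -ball_normE /ball_/=.
  rewrite addrA opprD addrCA subrr addr0 normrN.
  rewrite (le_lt_trans (ler_normD _ _))// !normrZ !ger0_norm//.
  apply: (@le_lt_trans _ _ (s * (`|u| + `|v| + 1))); last first.
    by rewrite /s divfK ?gt_eqF// ltr_pdivrMr// ltr_pMr// ltr1n.
  rewrite -wz !mulrDr; have := ler_wpM2r (normr_ge0 z) a1.
  by have := ler_wpM2r (normr_ge0 w) b1; lra.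
have Pu a b : 0 <= a <= s -> 0 <= b <= s -> ball x r (b *: u + (a *: v + x)).
  exact: P.
have Pv a b : 0 <= a <= s -> 0 <= b <= s -> ball x r (b *: v + (a *: u + x)).
  by apply: P; exact: addrC.
have [a [b [a_s b_s E1]]] := second_difference (x := x) (u := u) (v :=
  v) (f := f)
   (fun a b ha hb => let: conj (And4 d1 _ d2 _) _ := rP _ (Pv a b ha hb) in
      conj d1 d2) (ltW s0).
have [b' [a' [b's a's E2]]] := second_difference (x := x) (u := v) (v :=
  u) (f := f)
   (fun a b ha hb => let: conj (And4 _ d1 _ d2) _ := rP _ (Pu a b ha hb) in
      conj d1 d2) (ltW s0).
have [_ [H1 _]] := rP _ (Pv _ _ a_s b_s).
have [_ [_ H2]] := rP _ (Pu _ _ b's a's).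
have : 'D_v ('D_u f) (b *: v + (a *: u + x)) =
       'D_u ('D_v f) (a' *: u + (b' *: v + x)).
  apply: (mulfI (x := s ^+ 2)); first by rewrite expf_neq0// gt_eqF.
  have e3 : s *: v + (s *: u + x) = s *: u + (s *: v + x) by exact: addrCA.
  apply: etrans (esym E1) _; apply: etrans _ E2; rewrite e3.
  by move: (f _) (f _) (f _) (f _) => ? ? ? ?; ring.
move: H1 H2; rewrite {E1 E2}.
set A := 'D_v ('D_u f) x; set B := 'D_u ('D_v f) x; move: A B.
move: ('D_u ('D_v f) _) ('D_v _ _) => C D A B H1 H2 e1; rewrite {}e1 in H1;
  move: H1 H2.
by rewrite !ler_norml => /andP[? ?] /andP[? ?]; apply/andP; split; lra.
Qed.

End DirectionalDerivatives.

(** * Closure properties of smooth functions *)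

Section SmoothFunctions.
Context {R : realType} {n : nat} {W : set 'rV[R]_n} (Wo : open W).
Local Notation vec := 'rV[R]_n.
Implicit Types (f h : vec -> R) (x v : vec).

Definition C0 f := forall x, W x ->
  {for x, continuous f} /\ forall i, derivable f x (basis_vec i).

(** Derivatives are peeled off from the inside, whereas [iter_partial] adds them on the outside;
    this opens sums, products and inverses to induction on the order. *)
Fixpoint Ck (k : nat) f : Prop :=
  if k is k'.+1 then C0 f /\ forall i, Ck k' ('D_(basis_vec i) f) else C0 f.

Lemma CkS k f : Ck k.+1 f -> Ck k f.
Proof.
elim: k f => [|k IH] f; first by case.
by move=> [f0 fi]; split=> // i; apply: IH; exact: fi.
Qed.

Lemma iter_partial_rcons (s : seq 'I_n) i f :
  iter_partial (rcons s i) f = iter_partial s ('D_(basis_vec i) f).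
Proof. by rewrite /iter_partial foldr_rcons. Qed.

Lemma smooth_onP f : smooth_on W f <-> forall k, Ck k f.
Proof.
split=> [sf k|cf s].
  elim: k f sf => [|k IH] f sf; first exact: (sf [::]).
  split; first exact: (sf [::]).
  by move=> i; apply: IH => s; rewrite -iter_partial_rcons; exact: sf.
elim/last_ind: s f cf => [|s i IH] f cf; first exact: (cf 0).
by rewrite iter_partial_rcons; apply: IH => k; have [_] := cf k.+1; apply.
Qed.

Lemma near_W x : W x -> \forall y \near x, W y.
Proof. by move=> Wx; apply: open_nbhs_nbhs; split. Qed.

Lemma near_eqW (T : Type) (f h : vec -> T) x : (forall y, W y -> f y =
  h y) -> W x ->
  \forall y \near x, f y = h y.
Proof. by move=> e Wx; apply: filterS (near_W Wx) => y; apply: e. Qed.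

Lemma C0_eq f h : (forall x, W x -> f x = h x) -> C0 f -> C0 h.
Proof.
move=> e f0 x Wx; have [c d] := f0 x Wx; split.
  rewrite /prop_for /continuous_at -(e x Wx).
  apply: cvg_trans c; apply: (@near_eq_cvg _ _ (nbhs x)).
  exact: near_eqW e Wx.
by move=> i; apply: (near_eq_derivable _ (d i)); apply: near_eqW.
Qed.

Lemma Ck_eq k f h : (forall x, W x -> f x = h x) -> Ck k f -> Ck k h.
Proof.
elim: k f h => [|k IH] f h e; first exact: C0_eq.
move=> [f0 fi]; split; first exact: (C0_eq e f0).
move=> i; apply: IH (fi i) => x Wx.
by apply: near_eq_derive; apply: near_eqW.
Qed.

Lemma Ck_cst k c : Ck k (cst c).
Proof.
have c0 b : C0 (cst b).
  by move=> x _; split; [exact: cst_continuous | move=> i;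
    exact: derivable_cst].
elim: k c => [|k IH] c; first exact: c0.
split=> [|i]; first exact: c0.
by apply: Ck_eq (IH 0) => x _; rewrite derive_cst.
Qed.

Lemma Ck_D k f h : Ck k f -> Ck k h -> Ck k (f \+ h).
Proof.
have d0 a b : C0 a -> C0 b -> C0 (a \+ b).
  move=> a0 b0 x Wx; have [ca da] := a0 x Wx; have [cb db] := b0 x Wx.
  by split; [exact: continuousD | move=> i; exact: derivableD].
elim: k f h => [|k IH] f h; first exact: d0.
move=> [f0 fi] [h0 hi]; split=> [|i]; first exact: d0.
apply: Ck_eq (IH _ _ (fi i) (hi i)) => x Wx.
by rewrite /= deriveD//; [have [_] := f0 x Wx | have [_] := h0 x Wx].
Qed.

Lemma Ck_M k f h : Ck k f -> Ck k h -> Ck k (f \* h).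
Proof.
have m0 a b : C0 a -> C0 b -> C0 (a \* b).
  move=> a0 b0 x Wx; have [ca da] := a0 x Wx; have [cb db] := b0 x Wx.
  by split; [exact: continuousM | move=> i; exact: derivableM].
elim: k f h => [|k IH] f h; first exact: m0.
move=> fk hk; have [f0 fi] := fk; have [h0 hi] := hk.
split=> [|i]; first exact: m0.
apply: Ck_eq (Ck_D (IH _ _ (CkS fk) (hi i)) (IH _ _ (CkS hk) (fi i))) => x Wx.
by rewrite deriveM//; [have [_] := f0 x Wx | have [_] := h0 x Wx].
Qed.

Lemma Ck_V k f : (forall x, W x -> f x != 0) -> Ck k f -> Ck k (fun x =>
  (f x)^-1).
Proof.
move=> fn0.
have v0 : C0 f -> C0 (fun x => (f x)^-1).
  move=> f0 x Wx; have [cf df] := f0 x Wx.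
  by split; [apply: continuousV => //; exact: fn0 |
             move=> i; apply: derivableV => //; exact: fn0].
elim: k => [|k IH] fk; first exact: v0.
have [f0 fi] := fk; have fk1 := IH (CkS fk).
split=> [|i]; first exact: v0.
apply: Ck_eq (Ck_M (Ck_cst k (-1)) (Ck_M (Ck_M fk1 fk1) (fi i))) => x Wx.
have [_ df] := f0 x Wx.
by rewrite /= deriveV//; [rewrite -exprVn expr2 mulN1r scaleNr | exact: fn0].
Qed.

Lemma smooth_eq f h : (forall x, W x -> f x = h x) -> smooth_on W f ->
  smooth_on W h.
Proof. by move=> e /smooth_onP sf; apply/smooth_onP => k;
  apply: Ck_eq (sf k). Qed.

Lemma smooth_cst c : smooth_on W (cst c).
Proof. by apply/smooth_onP => k; exact: Ck_cst. Qed.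

Lemma smoothD f h : smooth_on W f -> smooth_on W h -> smooth_on W (f \+ h).
Proof.
by move=> /smooth_onP sf /smooth_onP sh; apply/smooth_onP => k; exact: Ck_D.
Qed.

Lemma smoothM f h : smooth_on W f -> smooth_on W h -> smooth_on W (f \* h).
Proof.
by move=> /smooth_onP sf /smooth_onP sh; apply/smooth_onP => k; exact: Ck_M.
Qed.

Lemma smoothV f : (forall x, W x -> f x != 0) -> smooth_on W f ->
  smooth_on W (fun x => (f x)^-1).
Proof.
by move=> f0 /smooth_onP sf; apply/smooth_onP => k; exact: Ck_V.
Qed.

Lemma smooth_partial i f : smooth_on W f -> smooth_on W ('D_(basis_vec i) f).
Proof. by move=> sf s; rewrite -iter_partial_rcons; exact: sf. Qed.

(** Smoothness speaks of coordinate directions only. These are added one at a time, each with its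
    continuous partial derivative. *)
Lemma smooth_derive f x v : smooth_on W f -> W x ->
  is_derive x v f (\sum_i v 0 i * 'D_(basis_vec i) f x).
Proof.
move=> sf Wx.
suff H (r : seq 'I_n) : is_derive x (\sum_(i <- r) v 0 i *: basis_vec i) f
    (\sum_(i <- r) v 0 i * 'D_(basis_vec i) f x).
  by have := H (index_enum 'I_n); rewrite -row_sum_delta.
elim/last_ind: r => [|r i IH]; first by rewrite !big_nil; exact: is_derive0.
rewrite -cats1 !big_cat !big_seq1 /=.
have D y : W y -> is_derive y (v 0 i *: basis_vec i) f
    (v 0 i * 'D_(basis_vec i) f y).
  by move=> Wy; apply: is_derive_scale_dir; have [_] := sf [::] y Wy.
have [d1 e1] := IH; have [d2 e2] := D x Wx; rewrite -e1 -e2.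
apply: (is_derive_add_dir d1).
  by apply: filterS (near_W Wx) => y /D[].
have c : {for x, continuous (cst (v 0 i) \* 'D_(basis_vec i) f)}.
  by apply: continuousM; [exact: cst_continuous | have [] := sf [:: i] x Wx].
rewrite /prop_for /continuous_at e2; apply: cvg_trans c;
  apply: (@near_eq_cvg _ _ (nbhs x)).
by apply: near_eqW => // y /D[_ ->].
Qed.

Lemma smooth_partialC i j f x : smooth_on W f -> W x ->
  'D_(basis_vec i) ('D_(basis_vec j) f) x =
  'D_(basis_vec j) ('D_(basis_vec i) f) x.
Proof.
move=> sf Wx; apply: derive_comm.
- apply: filterS (near_W Wx) => y Wy.
  have d k : derivable f y (basis_vec k) by have [_] := sf [::] y Wy.
  have d2 k l : derivable ('D_(basis_vec k) f) y (basis_vec l).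
    by have [_] := sf [:: k] y Wy.
  by split.
- by have [] := sf [:: i; j] x Wx.
- by have [] := sf [:: j; i] x Wx.
Qed.

End SmoothFunctions.

(** Functions vanish outside [W], so that equality in this ring is equality on
    [W]. *)
Record smooth_fun (R : realType) (n : nat) (W : set 'rV[R]_n) (Wo : open W) :=
  SFun {
  smooth_val :> 'rV[R]_n -> R;
  smooth_valP : smooth_on W smooth_val;
  smooth_val_out : forall x, ~ W x -> smooth_val x = 0 }.

(** * The ring of smooth functions, its derivations and evaluations *)

Section SmoothRing.
Context {R : realType} {n : nat} {W : set 'rV[R]_n} (Wo : open W).
Local Notation smooth_fun := (smooth_fun Wo).
Implicit Types (f h : smooth_fun) (x : 'rV[R]_n).

Lemma smooth_fun_eq f h : (forall x, W x -> f x = h x) -> f = h.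
Proof.
case: f h => [f fs f0] [h hs h0] /= e.
have {}e : f = h.
  by apply/funext => x; have [Wx|nWx] := pselect (W x);
    [exact: e | rewrite f0// h0].
by subst h; congr SFun; exact: Prop_irrelevance.
Qed.

Definition cutoff (u : 'rV[R]_n -> R) x : R := if pselect (W x) then u x else 0.

Lemma cutoffE u x : W x -> cutoff u x = u x.
Proof. by rewrite /cutoff; case: pselect. Qed.

Lemma cutoff0 u x : ~ W x -> cutoff u x = 0.
Proof. by rewrite /cutoff; case: pselect. Qed.

Lemma cutoff_smooth u : smooth_on W u -> smooth_on W (cutoff u).
Proof. by apply: (smooth_eq Wo) => x Wx; rewrite cutoffE. Qed.

Definition smooth_of u (su : smooth_on W u) : smooth_fun :=
  SFun Wo (cutoff_smooth su) (cutoff0 u).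

Lemma smooth_ofE u (su : smooth_on W u) x : W x -> smooth_of su x = u x.
Proof. exact: cutoffE. Qed.

HB.instance Definition _ := gen_eqMixin smooth_fun.
HB.instance Definition _ := gen_choiceMixin smooth_fun.

Let addf f h : smooth_fun := smooth_of (smoothD Wo (smooth_valP f) (smooth_valP
  h)).
Let mulf f h : smooth_fun := smooth_of (smoothM Wo (smooth_valP f) (smooth_valP
  h)).
Let cstf (c : R) : smooth_fun := smooth_of (smooth_cst Wo c).
Let oppf f : smooth_fun := mulf (cstf (-1)) f.

Let addfE f h x : W x -> addf f h x = f x + h x. Proof. exact: smooth_ofE. Qed.
Let mulfE f h x : W x -> mulf f h x = f x * h x. Proof. exact: smooth_ofE. Qed.
Let cstfE c x : W x -> cstf c x = c. Proof. exact: smooth_ofE. Qed.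
Let oppfE f x : W x -> oppf f x = - f x.
Proof. by move=> Wx; rewrite mulfE// cstfE// mulN1r. Qed.

Let addfA : associative addf.
Proof. by move=> a b c; apply: smooth_fun_eq => x Wx;
  rewrite !addfE// addrA. Qed.
Let addfC : commutative addf.
Proof. by move=> a b; apply: smooth_fun_eq => x Wx; rewrite !addfE// addrC. Qed.
Let add0f : left_id (cstf 0) addf.
Proof. by move=> a; apply: smooth_fun_eq => x Wx;
  rewrite addfE// cstfE// add0r. Qed.
Let addNf : left_inverse (cstf 0) oppf addf.
Proof.
by move=> a; apply: smooth_fun_eq => x Wx;
  rewrite addfE// oppfE// cstfE// addNr.
Qed.
HB.instance Definition _ := GRing.isZmodule.Build smooth_fun addfA addfC add0f
  addNf.

Let mulfA : associative mulf.
Proof. by move=> a b c; apply: smooth_fun_eq => x Wx;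
  rewrite !mulfE// mulrA. Qed.
Let mulfC : commutative mulf.
Proof. by move=> a b; apply: smooth_fun_eq => x Wx; rewrite !mulfE// mulrC. Qed.
Let mul1f : left_id (cstf 1) mulf.
Proof. by move=> a; apply: smooth_fun_eq => x Wx;
  rewrite mulfE// cstfE// mul1r. Qed.
Let mulfDl : left_distributive mulf addf.
Proof.
by move=> a b c; apply: smooth_fun_eq => x Wx; rewrite !(mulfE, addfE)// mulrDl.
Qed.
(** [W] may be empty, and then 1 = 0 in this ring. *)
HB.instance Definition _ :=
  GRing.Zmodule_isComPzRing.Build smooth_fun mulfA mulfC mul1f mulfDl.

Definition cst_smooth (c : R) : smooth_fun := smooth_of (smooth_cst Wo c).

Lemma smooth_funD f h x : W x -> (f + h) x =
  f x + h x. Proof. exact: smooth_ofE. Qed.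
Lemma smooth_funM f h x : W x -> (f * h) x =
  f x * h x. Proof. exact: smooth_ofE. Qed.
Lemma smooth_funN f x : W x -> (- f) x = - f x. Proof. exact: oppfE. Qed.
Lemma smooth_fun1 x : W x -> (1 : smooth_fun) x =
  1. Proof. exact: smooth_ofE. Qed.
Lemma smooth_fun0 x : (0 : smooth_fun) x = 0.
Proof. by have [Wx|] := pselect (W x); [exact: smooth_ofE | exact:
  smooth_val_out]. Qed.

Lemma smooth_fun_sum (I : finType) (F : I -> smooth_fun) x : W x ->
  (\sum_i F i) x = \sum_i F i x.
Proof.
move=> Wx; apply: (big_morph (fun f : smooth_fun => f x)) => [f h|];
  first exact: smooth_funD.
exact: smooth_fun0.
Qed.

(** The proof of [W x] is an argument because evaluation outside [W] sends 1 to 0 and is no ring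
    morphism. *)
Definition smooth_eval x of W x := fun f : smooth_fun => f x.

Section Eval.
Variables (x : 'rV[R]_n) (Wx : W x).

Let ev_zmod : zmod_morphism (smooth_eval Wx).
Proof. by move=> f h; rewrite /smooth_eval smooth_funD// smooth_funN. Qed.
HB.instance Definition _ := GRing.isZmodMorphism.Build smooth_fun R
  (smooth_eval Wx) ev_zmod.

Let ev_monoid : monoid_morphism (smooth_eval Wx).
Proof. by split=> [|f h]; rewrite /smooth_eval ?smooth_fun1 ?smooth_funM. Qed.
HB.instance Definition _ := GRing.isMonoidMorphism.Build smooth_fun R
  (smooth_eval Wx) ev_monoid.

End Eval.

Definition partial (i : 'I_n) f : smooth_fun :=
  smooth_of (smooth_partial i (smooth_valP f)).

Lemma partialE i f x : W x -> partial i f x = 'D_(basis_vec i) f x.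
Proof. exact: smooth_ofE. Qed.

Lemma derivable_sfun f x i : W x -> derivable f x (basis_vec i).
Proof. by move=> Wx; have [_] := smooth_valP f [::] Wx; apply. Qed.

Lemma derive_eqW (u v : 'rV[R]_n -> R) x w : (forall y, W y -> u y = v y) ->
  W x ->
  'D_w u x = 'D_w v x.
Proof. by move=> e Wx; apply: near_eq_derive; exact: (near_eqW Wo e Wx). Qed.

Lemma partialD i f h : partial i (f + h) = partial i f + partial i h.
Proof.
apply: smooth_fun_eq => x Wx; rewrite smooth_funD// !partialE//.
rewrite (derive_eqW _ (fun y => @smooth_funD f h y) Wx).
by have [_ ->] := is_deriveD (derivableP (@derivable_sfun f x i Wx))
  (derivableP (@derivable_sfun h x i Wx)).
Qed.

Lemma partialM i f h : partial i (f * h) = partial i f * h + f * partial i h.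
Proof.
apply: smooth_fun_eq => x Wx; rewrite smooth_funD// !smooth_funM// !partialE//.
rewrite (derive_eqW _ (fun y => @smooth_funM f h y) Wx).
have [_ ->] := is_deriveM (derivableP (@derivable_sfun f x i Wx))
  (derivableP (@derivable_sfun h x i Wx)).
rewrite -[_ *: _]/(_ * _) -[h x *: _]/(_ * _); ring.
Qed.

Lemma partialC i j f : partial i (partial j f) = partial j (partial i f).
Proof.
have E k l x : W x -> partial k (partial l f) x =
  'D_(basis_vec k) ('D_(basis_vec l) f) x.
  move=> Wx; apply: etrans (partialE k (partial l f) Wx) _.
  exact: (derive_eqW (basis_vec k) (fun y => @partialE l f y) Wx).
apply: smooth_fun_eq => x Wx; apply: etrans (E i j x Wx) _;
  apply: etrans _ (esym (E j i x Wx)).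
exact: (smooth_partialC Wo i j (smooth_valP f) Wx).
Qed.

End SmoothRing.

(** * Metric, connection and curvature over the ring of smooth functions *)

Section Geometry.
Context {R : realType} {n : nat} {W : set 'rV[R]_n} (Wo : open W).
Context (G : 'rV[R]_n -> 'M[R]_n).
Hypothesis Gs : forall i j, smooth_on W (fun x => G x i j).
Hypothesis GT : forall x, W x -> (G x)^T = G x.
Hypothesis Gu : forall x, W x -> G x \in unitmx.
Local Notation smooth_fun := (smooth_fun Wo).
Implicit Types (f h : smooth_fun) (x : 'rV[R]_n).

Definition metric_mx : 'M[smooth_fun]_n := \matrix_(i, j) smooth_of Wo (Gs i j).

Lemma eval_metric_mx x (Wx : W x) : map_mx (@smooth_eval _ _ _ Wo _ Wx)
  metric_mx = G x.
Proof. by apply/matrixP => i j; rewrite !mxE /smooth_eval smooth_ofE. Qed.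

Lemma det_metric_mx x : W x -> (\det metric_mx) x = \det (G x).
Proof. by move=> Wx; rewrite -(eval_metric_mx Wx) det_map_mx. Qed.

Lemma det_metric_mx_neq0 x : W x -> (\det metric_mx) x != 0.
Proof. by move=> Wx; rewrite det_metric_mx// -unitfE -unitmxE Gu. Qed.

Definition metric_det_inv : smooth_fun :=
  smooth_of Wo (smoothV Wo det_metric_mx_neq0 (smooth_valP (\det metric_mx))).

(** Cramer's rule: only the reciprocal of the determinant has to be shown smooth. *)
Definition metric_inv_mx : 'M[smooth_fun]_n := metric_det_inv *: \adj metric_mx.

Lemma metric_mxV : metric_mx *m metric_inv_mx = 1%:M.
Proof.
rewrite /metric_inv_mx -scalemxAr mul_mx_adj -[_%:M]scalemx1 scalerA.
suff -> : metric_det_inv * \det metric_mx = 1 by rewrite scale1r.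
apply: smooth_fun_eq => x Wx; rewrite smooth_funM// smooth_ofE// mulVf
  ?smooth_fun1//.
exact: det_metric_mx_neq0.
Qed.

Lemma eval_metric_inv_mx x (Wx : W x) : map_mx (@smooth_eval _ _ _ Wo _ Wx)
  metric_inv_mx = invmx (G x).
Proof.
have := congr1 (map_mx (@smooth_eval _ _ _ Wo _ Wx)) metric_mxV.
rewrite map_mxM map_mx1 eval_metric_mx => e.
by rewrite -[LHS](mulKmx (Gu Wx)) e mulmx1.
Qed.

Lemma metric_mxT : metric_mx^T = metric_mx.
Proof.
apply/matrixP => i j; rewrite !mxE; apply: smooth_fun_eq => x Wx;
  rewrite !smooth_ofE//.
by rewrite -{1}GT// mxE.
Qed.

Lemma half_smooth : cst_smooth Wo 2^-1 + cst_smooth Wo 2^-1 = 1.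
Proof.
by apply: smooth_fun_eq => x Wx; rewrite smooth_funD// smooth_fun1//
  !smooth_ofE//= /cst; field.
Qed.

Definition smooth_koszul : koszul smooth_fun n :=
  coord_koszul (@partialD _ _ _ Wo) (@partialM _ _ _ Wo) (@partialC _ _ _ Wo)
    metric_mxT metric_mxV half_smooth.

(** Dictionary between the fields of the statement, arbitrary outside [W], and vectors over the
    ring; the lemmas below carry each operator across. *)
Definition rep (X : 'rV[R]_n -> 'rV[R]_n) (XS : 'rV[smooth_fun]_n) :=
  forall x k, W x -> X x 0 k = XS 0 k x.

Definition smooth_field (X : 'rV[R]_n -> 'rV[R]_n) (sX : smooth_map W X) :
  'rV[smooth_fun]_n :=
  \row_k smooth_of Wo (sX k).

Lemma rep_field X (sX : smooth_map W X) : rep X (smooth_field sX).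
Proof. by move=> x k Wx; rewrite mxE smooth_ofE. Qed.

Definition cst_field (u : 'rV[R]_n) : 'rV[smooth_fun]_n :=
  map_mx (cst_smooth Wo) u.

Lemma rep_cst u : rep (cst u) (cst_field u).
Proof. by move=> x k Wx; rewrite mxE smooth_ofE. Qed.

Lemma rep_derive X XS Y YS : rep X XS -> rep Y YS ->
  rep (fun x => 'D_(X x) Y x) (map_mx (dact (@partial _ _ _ Wo) XS) YS).
Proof.
move=> rX rY x k Wx.
have sY j : smooth_on W (fun y => Y y 0 j).
  by apply: (smooth_eq Wo _ (smooth_valP (YS 0 j))) => y Wy; rewrite -rY.
have d i j : is_derive x (X x) (fun y => Y y i j)
    (\sum_l X x 0 l * 'D_(basis_vec l) (fun y => Y y 0 j) x).
  by rewrite (ord1 i); exact: (smooth_derive Wo (X x) (sY j) Wx).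
rewrite derive_mx; last by apply/derivable_mxP => i j; have [] := d i j.
rewrite mxE; have [_ ->] := d 0 k.
rewrite mxE /dact smooth_fun_sum//; apply: eq_bigr => l _.
rewrite smooth_funM// -rX// partialE//; congr (_ * _).
by apply: (derive_eqW Wo) => // y Wy; exact: rY.
Qed.

Lemma gam_smooth k i j x : W x ->
  gam (@partial _ _ _ Wo) metric_mx metric_inv_mx (cst_smooth Wo 2^-1) k i j x
    = christoffel G k i j x.
Proof.
move=> Wx; rewrite /gam /christoffel smooth_funM// smooth_ofE//
  smooth_fun_sum//; congr (_ * _).
apply: eq_bigr => l _; rewrite smooth_funM//; congr (_ * _).
  by rewrite -(eval_metric_inv_mx Wx) [RHS]mxE.
have e a b c : partial a (metric_mx b c) x = 'D_(basis_vec a) (fun y =>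
  G y b c) x.
  rewrite partialE//; apply: (derive_eqW Wo) => // y Wy.
  by rewrite mxE smooth_ofE.
by rewrite !smooth_funD// smooth_funN// !e.
Qed.

Lemma rep_nabla X XS Y YS : rep X XS -> rep Y YS ->
  rep (levi_civita G X Y) (nabla smooth_koszul XS YS).
Proof.
move=> rX rY x k Wx; rewrite mxE (rep_derive rX rY)// [RHS]/=.
rewrite [in RHS]mxE smooth_funD//; congr (_ + _).
rewrite [LHS]mxE [in RHS]mxE smooth_fun_sum// exchange_big; apply: eq_bigr =>
  j _.
rewrite smooth_funM// mxE smooth_fun_sum// mulr_sumr; apply: eq_bigr => i _.
by rewrite smooth_funM// gam_smooth// rX// rY//; ring.
Qed.

Lemma repB X XS Y YS : rep X XS -> rep Y YS -> rep (fun x =>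
  X x - Y x) (XS - YS).
Proof. by move=> rX rY x k Wx; rewrite !mxE smooth_funD// smooth_funN// rX//
  rY. Qed.

Lemma rep_br X XS Y YS : rep X XS -> rep Y YS ->
  rep (lie_bracket X Y) (bracket smooth_koszul XS YS).
Proof.
move=> rX rY x k Wx; rewrite /bracket [nabla _ _ _ - _]dbrE;
  last exact: metric_mxT.
exact: (repB (rep_derive rX rY) (rep_derive rY rX)).
Qed.

Lemma rep_curv X XS Y YS Z ZS : rep X XS -> rep Y YS -> rep Z ZS ->
  rep (curvature G X Y Z) (curv smooth_koszul XS YS ZS).
Proof.
move=> rX rY rZ.
exact: (repB (repB (rep_nabla rX (rep_nabla rY rZ)) (rep_nabla rY (rep_nabla rX
  rZ)))
  (rep_nabla (rep_br rX rY) rZ)).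
Qed.

Lemma rep_nabla_curv U US X XS Y YS Z ZS : rep U US -> rep X XS ->
  rep Y YS -> rep Z ZS ->
  rep (nabla_curvature G U X Y Z) (nabla_curv smooth_koszul US XS YS ZS).
Proof.
move=> rU rX rY rZ.
exact: (repB (repB (repB (rep_nabla rU (rep_curv rX rY rZ))
  (rep_curv (rep_nabla rU rX) rY rZ)) (rep_curv rX (rep_nabla rU rY) rZ))
  (rep_curv rX rY (rep_nabla rU rZ))).
Qed.

Lemma rep_metric X XS Y YS x : rep X XS -> rep Y YS -> W x ->
  mdot (G x) (X x) (Y x) = metric smooth_koszul XS YS x.
Proof.
move=> rX rY Wx; rewrite /mdot [metric _ _ _]/= /dgm mxE [in RHS]mxE
  smooth_fun_sum//.
apply: eq_bigr => j _; rewrite smooth_funM// !mxE smooth_fun_sum// rY//;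
  congr (_ * _).
by apply: eq_bigr => i _; rewrite smooth_funM// !mxE smooth_ofE// rX.
Qed.

End Geometry.

(** * Evaluation at a point *)

Section Trilinear.
Context (R : fieldType) (n : nat) (T : 'rV[R]_n -> 'rV[R]_n -> 'rV[R]_n ->
  'rV[R]_n).
Hypothesis T_lin1 : forall a u u' v w, T (a *: u + u') v w =
  a *: T u v w + T u' v w.
Hypothesis T_lin3 : forall a u v w w', T u v (a *: w + w') =
  a *: T u v w + T u v w'.
Hypothesis TC : forall u v w, T u v w = - T v u w.

Definition op_mx u v : 'M[R]_n := \matrix_(m, k) T u v (delta_mx 0 m) 0 k.

Lemma op_mxE u v w : T u v w = w *m op_mx u v.
Proof.
have T0 : T u v 0 = 0.
  by apply: (addrI (1 *: T u v 0)); rewrite -T_lin3 scaler0 !addr0 scale1r.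
rewrite {1}[w]row_sum_delta (big_morph (T u v) (id1 := 0) (op1 := +%R)) //;
  last first.
  by move=> w1 w2; rewrite -[w1 in LHS]scale1r T_lin3 scale1r.
apply/rowP => k; rewrite [RHS]mxE summxE; apply: eq_bigr => i _.
by rewrite -[_ *: delta_mx 0 i]addr0 T_lin3 T0 addr0 !mxE.
Qed.

Lemma op_mx_lin a u u' v : op_mx (a *: u + u') v = a *: op_mx u v + op_mx u' v.
Proof. by apply/matrixP => m k; rewrite !mxE T_lin1 !mxE. Qed.

Lemma op_mxC u v : op_mx u v = - op_mx v u.
Proof. by apply/matrixP => m k; rewrite !mxE TC !mxE. Qed.

Lemma op_mx_sum (u v : 'rV[R]_n) : op_mx u v =
  \sum_i \sum_j (u 0 i * v 0 j) *: op_mx (delta_mx 0 i) (delta_mx 0 j).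
Proof.
have S1 a b : op_mx a b = \sum_i a 0 i *: op_mx (delta_mx 0 i) b.
  have T0 : op_mx 0 b = 0.
    by apply: (addrI (1 *: op_mx 0 b)); rewrite -op_mx_lin scaler0 !addr0
      scale1r.
  rewrite {1}[a]row_sum_delta.
  rewrite (big_morph (op_mx ^~ b) (id1 := 0) (op1 := +%R)) => [|a1 a2|//];
    last first.
    by rewrite -[a1 in LHS]scale1r op_mx_lin scale1r.
  by apply: eq_bigr => i _; rewrite -[_ *: delta_mx 0 i]addr0 op_mx_lin T0
    addr0.
rewrite S1; apply: eq_bigr => i _; rewrite op_mxC S1 -sumrN scaler_sumr.
by apply: eq_bigr => j _; rewrite -scalerN -op_mxC scalerA.
Qed.

(** The double sum over the components of a bivector meets every pair of indices twice, which
    explains the [2^-1] in [curvature_endo]. *)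
Lemma wedge_sum (u v : 'rV[R]_n) (D : 'M[R]_n) : 2%:R != 0 :> R ->
  (2^-1 *: \sum_i \sum_j
   (u 0 i * v 0 j - v 0 i * u 0 j) *:
   (D *m op_mx (delta_mx 0 i) (delta_mx 0 j))) = D *m op_mx u v.
Proof.
move=> two; have -> : \sum_i \sum_j (u 0 i * v 0 j - v 0 i * u 0 j) *:
   (D *m op_mx (delta_mx 0 i) (delta_mx 0 j)) = D *m (op_mx u v - op_mx v u).
  rewrite (op_mx_sum u v) (op_mx_sum v u) -sumrB mulmx_sumr;
    apply: eq_bigr => i _.
  rewrite -sumrB mulmx_sumr; apply: eq_bigr => j _.
  by rewrite -scalerBl scalemxAr.
rewrite (op_mxC v u) opprK -mulr2n scalemxAr; congr (_ *m _).
by rewrite -scaler_nat scalerA mulVf// scale1r.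
Qed.

End Trilinear.

Section Evaluation.
Context (R : realType) (n : nat) (F : comPzRingType) (C : koszul F n).
Context (pt : Type) (ev : pt -> {rmorphism F -> R}) (cs : R -> F).
Context (G : pt -> 'M[R]_n).
Hypothesis ev_inj : forall f h, (forall p, ev p f = ev p h) -> f = h.
Hypothesis ev_cs : forall p a, ev p (cs a) = a.
Hypothesis act_cs : forall X a, act C X (cs a) = 0.
Local Notation vec := 'rV[R]_n.
Local Notation svec := 'rV[F]_n.
Implicit Types (f h : F) (p : pt) (u v w : vec) (K L X Y Z : svec).

Definition evalv p X : vec := map_mx (ev p) X.
Definition constv u : svec := map_mx cs u.

Hypothesis ev_gm : forall p X Y, ev p (metric C X Y) =
  mdot (G p) (evalv p X) (evalv p Y).
Hypothesis G_unit : forall p, G p \in unitmx.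

Lemma evalv_lin p f X Y : evalv p (f *: X + Y) =
  ev p f *: evalv p X + evalv p Y.
Proof. by rewrite /evalv map_mxD map_mxZ. Qed.

Lemma evalvD p X Y : evalv p (X + Y) = evalv p X + evalv p Y.
Proof. exact: map_mxD. Qed.

Lemma evalvN p X : evalv p (- X) = - evalv p X.
Proof. exact: map_mxN. Qed.

Lemma evalvB p X Y : evalv p (X - Y) = evalv p X - evalv p Y.
Proof. by rewrite evalvD evalvN. Qed.

Lemma evalvB3 p X Y Z U :
  evalv p (X - Y - Z - U) = evalv p X - evalv p Y - evalv p Z - evalv p U.
Proof. by rewrite !evalvB. Qed.

Lemma evalv0 p : evalv p 0 = 0.
Proof. exact: map_mx0. Qed.

Lemma evalvZ p f X : evalv p (f *: X) = ev p f *: evalv p X.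
Proof. exact: map_mxZ. Qed.

Lemma evalv_sum (I : finType) (X : I -> svec) p :
  evalv p (\sum_i X i) = \sum_i evalv p (X i).
Proof. by apply: (big_morph (evalv p)) => [Y Z|];
  [exact: evalvD | exact: evalv0]. Qed.

Lemma evalv_const p u : evalv p (constv u) = u.
Proof. by apply/rowP => k; rewrite !mxE ev_cs. Qed.

Lemma evalv_inj X Y : (forall p, evalv p X = evalv p Y) -> X = Y.
Proof.
move=> e; apply/rowP => k; apply: ev_inj => p.
by have := congr1 (fun u : vec => u 0 k) (e p); rewrite !mxE.
Qed.

(** Linearity over the ring of functions makes a map tensorial: expanded in the coordinate fields,
    its value at [p] involves only the components of the argument at [p]. *)
Lemma evalv_tensor (phi : svec -> svec) p X Y :
  (forall f Z Z', phi (f *: Z + Z') = f *: phi Z + phi Z') ->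
  evalv p X = evalv p Y -> evalv p (phi X) = evalv p (phi Y).
Proof.
move=> lin e.
have p0 : phi 0 = 0.
  by apply: (addrI (1 *: phi 0)); rewrite -lin scaler0 !addr0 scale1r.
have E Z : evalv p (phi Z) = \sum_i evalv p Z 0 i *: evalv p (phi (delta_mx 0
  i)).
  rewrite {1}[Z]row_sum_delta (big_morph phi (id1 := 0) (op1 := +%R)) =>
    [|X' Y'|//].
    rewrite evalv_sum; apply: eq_bigr => i _.
    by rewrite -[_ *: delta_mx 0 i]addr0 lin p0 addr0 evalvZ mxE.
  by rewrite -[X' in LHS]scale1r lin scale1r.
by rewrite !E e.
Qed.

(** Endomorphisms act on row vectors from the right: nabla_u K has the value
    [u *m cov_mx p K] at [p]. *)
Definition cov_mx p K : 'M[R]_n :=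
  \matrix_(i, j) evalv p (nabla C (constv (delta_mx 0 i)) K) 0 j.

Lemma nabla_eval p X K : evalv p (nabla C X K) = evalv p X *m cov_mx p K.
Proof.
have -> : evalv p (nabla C X K) =
    evalv p (nabla C (\sum_i X 0 i *: constv (delta_mx 0 i)) K).
  apply: (evalv_tensor (phi := fun Z => nabla C Z K)) => [f Z Z'|].
    exact: nabla_lin.
  rewrite evalv_sum {1}[evalv p X]row_sum_delta; apply: eq_bigr => i _.
  by rewrite evalvZ evalv_const mxE.
rewrite (big_morph (nabla C ^~ K) (id1 := 0) (op1 := +%R)) => [|X' Y'|];
  last 2 first.
- exact: nablaDl.
- exact: nabla0l.
rewrite evalv_sum; apply/rowP => k; rewrite summxE [RHS]mxE.
by apply: eq_bigr => i _; rewrite nablaZl evalvZ !mxE.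
Qed.

Definition curv_at p u v w : vec := evalv p (curv C (constv u) (constv v)
  (constv w)).

Lemma curv_eval p X Y Z : evalv p (curv C X Y Z) =
  curv_at p (evalv p X) (evalv p Y) (evalv p Z).
Proof.
have c X' := evalv_const p (evalv p X').
have -> : evalv p (curv C X Y Z) = evalv p (curv C (constv (evalv p X)) Y Z).
  apply: (evalv_tensor (phi := fun Z' => curv C Z' Y Z)) => [f A B|].
    by rewrite curvDl curvZl.
  by rewrite c.
have -> : evalv p (curv C (constv (evalv p X)) Y Z) =
          evalv p (curv C (constv (evalv p X)) (constv (evalv p Y)) Z).
  apply: (evalv_tensor (phi := fun Z' => curv C (constv (evalv p X)) Z' Z)) =>
    [f A B|].
    by rewrite curvDm curvZm.
  by rewrite c.
apply: (evalv_tensor (phi := fun Z' => curv C _ _ Z')) => [f A B|].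
  by rewrite curvDr curvZr.
by rewrite c.
Qed.

Lemma curv_at_lin1 p a u u' v w :
  curv_at p (a *: u + u') v w = a *: curv_at p u v w + curv_at p u' v w.
Proof.
have e : evalv p (cs a *: constv u + constv u') = a *: u + u'.
  by rewrite evalv_lin !evalv_const ev_cs.
rewrite -{1}e -{1}(evalv_const p v) -{1}(evalv_const p w) -curv_eval curvDl
  curvZl evalv_lin.
by rewrite ev_cs.
Qed.

Lemma curv_at_lin3 p a u v w w' :
  curv_at p u v (a *: w + w') = a *: curv_at p u v w + curv_at p u v w'.
Proof.
have e : evalv p (cs a *: constv w + constv w') = a *: w + w'.
  by rewrite evalv_lin !evalv_const ev_cs.
rewrite -{1}e -{1}(evalv_const p u) -{1}(evalv_const p v) -curv_eval curvDr
  curvZr evalv_lin.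
by rewrite ev_cs.
Qed.

Lemma curv_atC p u v w : curv_at p u v w = - curv_at p v u w.
Proof. by rewrite /curv_at curvC evalvN. Qed.

Lemma curv_at_skew p u v w z :
  mdot (G p) (curv_at p u v w) z = - mdot (G p) w (curv_at p u v z).
Proof.
by rewrite -{1}(evalv_const p z) -{2}(evalv_const p w) -!ev_gm curv_skew
  rmorphN.
Qed.

Lemma curv_at_pair p u v w z :
  mdot (G p) (curv_at p u v w) z = mdot (G p) (curv_at p w z u) v.
Proof.
by rewrite -{1}(evalv_const p z) -{2}(evalv_const p v) -!ev_gm curv_pair.
Qed.

Lemma curv_at0 p v w : curv_at p 0 v w = 0.
Proof.
by apply: (addrI (1 *: curv_at p 0 v w)); rewrite -curv_at_lin1 scaler0 !addr0
  scale1r.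
Qed.

Lemma curv_at0r p u v : curv_at p u v 0 = 0.
Proof.
by apply: (addrI (1 *: curv_at p u v 0)); rewrite -curv_at_lin3 scaler0 !addr0
  scale1r.
Qed.

Lemma alg_act_eval p K X Y Z :
  evalv p (alg_act C (fun U => nabla C U K) X Y Z) =
  mx_act (curv_at p) (cov_mx p K) (evalv p X) (evalv p Y) (evalv p Z).
Proof. by rewrite /alg_act /mx_act evalvB3 !curv_eval !nabla_eval curv_eval.
  Qed.

(** [U] enters through its value at [p] alone, so it may be exchanged for a Killing field with this
    value. *)
Lemma nabla_curv_eval p U X Y Z : evalv p (nabla_curv C U X Y Z) =
  evalv p U *m cov_mx p (curv C X Y Z)
  - curv_at p (evalv p U *m cov_mx p X) (evalv p Y) (evalv p Z)
  - curv_at p (evalv p X) (evalv p U *m cov_mx p Y) (evalv p Z)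
  - curv_at p (evalv p X) (evalv p Y) (evalv p U *m cov_mx p Z).
Proof. by rewrite /nabla_curv evalvB3 !curv_eval !nabla_eval. Qed.

Lemma killing_of_cst K : (forall u v,
    metric C (nabla C (constv u) K) (constv v) + metric C (constv u) (nabla C
      (constv v) K) = 0) ->
  killing C K.
Proof.
move=> h X Y; apply: ev_inj => p.
have := congr1 (ev p) (h (evalv p X) (evalv p Y)).
by rewrite !rmorphD !ev_gm !nabla_eval !evalv_const.
Qed.

Lemma mdot_sym p u v : mdot (G p) u v = mdot (G p) v u.
Proof. by rewrite -(evalv_const p u) -(evalv_const p v) -!ev_gm metricC. Qed.

Context (VS : svec).
Hypothesis VS_parallel : forall X, nabla C X VS = 0.
Hypothesis VS_null : metric C VS VS = 0.
Hypothesis VS_curv : forall p u v w, mdot (G p) u (evalv p VS) = 0 ->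
  mdot (G p) v (evalv p VS) = 0 -> curv_at p u v w = 0.

Definition killing_perp K := killing C K /\ metric C K VS = 0.

Lemma nabla_perp X K : metric C K VS = 0 -> metric C (nabla C X K) VS = 0.
Proof.
move=> e; have := act_metric C X K VS.
by rewrite e VS_parallel metric0r act0 addr0 => <-.
Qed.

Lemma curv_perp K L Z : metric C K VS = 0 -> metric C L VS = 0 ->
  curv C K L Z = 0.
Proof.
move=> eK eL; apply: evalv_inj => p; rewrite curv_eval evalv0.
by apply: VS_curv; rewrite -ev_gm ?eK ?eL rmorph0.
Qed.

Lemma curv_VS X Y : curv C X Y VS = 0.
Proof. by rewrite /curv !VS_parallel !nabla0 !subr0. Qed.

Lemma nabla_lin_cst a X K L :
  nabla C X (cs a *: K + L) = cs a *: nabla C X K + nabla C X L.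
Proof. by rewrite nablaD nablaM act_cs scale0r add0r. Qed.

Lemma cov_mx_lin p a K L :
  cov_mx p (cs a *: K + L) = a *: cov_mx p K + cov_mx p L.
Proof.
by apply/matrixP => i j; rewrite !mxE nabla_lin_cst !mxE rmorphD rmorphM ev_cs.
Qed.

Lemma killing_perp_lin a K L : killing_perp K -> killing_perp L ->
  killing_perp (cs a *: K + L).
Proof.
move=> [kK pK] [kL pL]; split; last by rewrite metric_lin pK pL mulr0 addr0.
move=> X Y; rewrite !nabla_lin_cst metricDl metricZl metricDr [metric C X (_ *:
  _)]metricC metricZl.
rewrite (metricC C _ X) (killing_skew _ _ kK) (killing_skew _ _ kL); ring.
Qed.

Lemma killing_perp_br K L : killing_perp K -> killing_perp L ->
  killing_perp (bracket C K L).
Proof.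
move=> [kK pK] [kL pL]; split; first exact: killing_br.
by rewrite /bracket metricBl !nabla_perp// subrr.
Qed.

Lemma killing_perp_parallel : killing_perp VS.
Proof. by split=> // X Y; rewrite !VS_parallel metric0l metric0r addr0. Qed.

Lemma cov_mx_VS p : cov_mx p VS = 0.
Proof. by apply/matrixP => i j; rewrite !mxE VS_parallel mxE rmorph0. Qed.

(** The curvature term of [nabla_br_killing] vanishes by [curv_perp]. On rows, the composite A_L A_K
    is the product [cov_mx p K *m cov_mx p L]. *)
Lemma cov_mx_br p K L : killing_perp K -> killing_perp L ->
  cov_mx p (bracket C K L) = cov_mx p K *m cov_mx p L - cov_mx p L *m cov_mx p
    K.
Proof.
move=> [kK pK] [kL pL]; apply/row_matrixP => i.
have -> : row i (cov_mx p (bracket C K L)) =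
  evalv p (nabla C (constv (delta_mx 0 i)) (bracket C K L)).
  by apply/rowP => j; rewrite mxE [LHS]mxE.
rewrite nabla_br_killing// curv_perp// addr0 evalvB !nabla_eval evalv_const.
by rewrite [RHS]rowE mulmxBr !mulmxA.
Qed.

Variable p : pt.
Hypothesis G_lorentz : lorentz_form (G p).
Hypothesis VS_neq0 : evalv p VS != 0.
Hypothesis killing_span : forall u, mdot (G p) u (evalv p VS) = 0 ->
  exists (m : nat) (K : 'I_m -> svec),
    (forall i, killing_perp (K i)) /\ (u <= \matrix_i evalv p (K i))%MS.

(** The coefficients of the span at [p] are extended as constants, which keeps the combination
    Killing. *)
Lemma killing_perp_ex u : mdot (G p) u (evalv p VS) = 0 ->
  exists2 K, killing_perp K & evalv p K = u.
Proof.
move=> /killing_span[m [K [kK /submxP[D ->]]]].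
exists (\sum_i cs (D 0 i) *: K i); last first.
  rewrite evalv_sum; apply/rowP => k; rewrite summxE mxE.
  by apply: eq_bigr => i _; rewrite evalvZ ev_cs !mxE.
have k0 : killing_perp 0.
  by split=> [X Y|]; rewrite ?nabla0 ?metric0l ?metric0r ?addr0// nabla0
    metric0r.
elim: (index_enum _) => [|i s IH]; first by rewrite big_nil.
by rewrite big_cons; exact: killing_perp_lin.
Qed.

Definition killing_jet u (A : 'M[R]_n) := exists2 K, killing_perp K & evalv p K
  = u /\ cov_mx p K = A.

Lemma nabla_curv_perp_eq0 s u v w : mdot (G p) s (evalv p VS) = 0 ->
  evalv p (nabla_curv C (constv s) (constv u) (constv v) (constv w)) = 0.
Proof.
move=> ps; have [K kK es] := killing_perp_ex ps.
have nabla_curvK U X Y Z : evalv p U = evalv p K ->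
    evalv p (nabla_curv C U X Y Z) = mx_act (curv_at p) (cov_mx p K) (evalv p
      X) (evalv p Y) (evalv p Z).
  by move=> e; rewrite nabla_curv_eval e -nabla_curv_eval nabla_curv_killing
    ?alg_act_eval//; case: kK.
rewrite nabla_curvK ?evalv_const//.
set b := mdot (G p).
have nd := mdot_nondeg (G_unit p).
have VV : b (evalv p VS) (evalv p VS) = 0.
  by rewrite /b -ev_gm VS_null rmorph0.
have [f [fV frame]] := lorentz_screen G_lorentz VS_neq0 VV.
have [N bN] : exists N, b N (evalv p VS) = 1.
  have [N bN0] : exists N, b N (evalv p VS) != 0.
    apply: contrapT => h; move/eqP: VS_neq0; apply; apply: nd => y.
    by apply: contrapT => /eqP y0; apply: h; exists y; rewrite /b mdot_sym.
  exists ((b N (evalv p VS))^-1 *: N); rewrite -[_ *: N]addr0 /b mdot_lin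
    mulVf//.
  by rewrite /mdot !mul0mx mxE addr0.
have kpK : killing_jet s (cov_mx p K) by exists K.
have perpK L : killing_perp L -> b (evalv p L) (evalv p VS) = 0.
  by move=> [_ e]; rewrite /b -ev_gm e rmorph0.
apply: (mx_act_eq0 (b := b) (V := evalv p VS) (N := N) (f := f) (Rm :=
  curv_at p)
  (kp := killing_jet) _ _ _ _ _ _ _ _ _ _ _ _ _ _ _ _ _ _ _ _ _ _ _ _ _ kpK) =>
    //.
- by move=> *; exact: mdot_lin.
- by move=> *; exact: mdot_sym.
- by move=> *; exact: curv_at_lin1.
- by move=> *; exact: curv_atC.
- by move=> *; exact: curv_at_skew.
- by move=> *; exact: curv_at_pair.
- by move=> x y; rewrite -(evalv_const p x) -(evalv_const p y) -curv_eval
  curv_VS evalv0.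
- by move=> *; exact: VS_curv.
- move=> a _ _ _ _ [L kL [<- <-]] [M kM [<- <-]]; exists (cs a *: L + M).
    exact: killing_perp_lin.
  by rewrite evalv_lin ev_cs cov_mx_lin.
- move=> _ _ _ _ [L kL [<- <-]] [M kM [<- <-]]; exists (bracket C L M).
    exact: killing_perp_br.
  by rewrite cov_mx_br// /bracket evalvB !nabla_eval.
- by exists VS; [exact: killing_perp_parallel | rewrite cov_mx_VS].
- by move=> _ _ [L kL [<- _]]; exact: perpK.
- move=> _ _ x y [L [kL _] [_ <-]].
  rewrite -(evalv_const p x) -(evalv_const p y) -!nabla_eval /b -!ev_gm.
  by rewrite (killing_skew _ _ kL) rmorphN.
- move=> _ _ x [L [_ pL] [_ <-]].
  by rewrite -(evalv_const p x) -nabla_eval /b -ev_gm nabla_perp// rmorph0.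
- by move=> x /killing_perp_ex[L kL e]; exists (cov_mx p L), L.
(* The curvatures that must vanish do so because covariant derivatives of fields orthogonal to the
   parallel [VS] remain orthogonal to it. *)
- move=> _ _ _ _ x z [L kL [<- <-]] [M kM [<- <-]].
  rewrite -(evalv_const p x) -(evalv_const p z) -!alg_act_eval;
    congr (evalv p _).
  have [k1 p1] := kL; have [k2 p2] := kM.
  by apply: alg_act_sym => // Y; apply: curv_perp => //; exact: nabla_perp.
(* For a Killing field vanishing at [p], the action of its jet is the covariant derivative of the
   curvature along the zero vector. *)
- move=> _ x y z [L [kL _] [eL <-]].
  rewrite -(evalv_const p x) -(evalv_const p y) -(evalv_const p z)
    -alg_act_eval -nabla_curv_killing//.
  by rewrite nabla_curv_eval eL !mul0mx !curv_at0 (curv_atC _ _ 0) curv_at0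
    curv_at0r !oppr0 !addr0.
Qed.

End Evaluation.

(** * From a chart to the theorem *)

Section Chart.
Context {R : realType} {n : nat} {W : set 'rV[R]_n} (Wo : open W).
Context (G : 'rV[R]_n -> 'M[R]_n).
Hypothesis Gs : forall i j, smooth_on W (fun x => G x i j).
Hypothesis GT : forall x, W x -> (G x)^T = G x.
Hypothesis Gu : forall x, W x -> G x \in unitmx.
Local Notation vec := 'rV[R]_n.
Local Notation svec := 'rV[smooth_fun Wo]_n.
Local Notation C := (@smooth_koszul R n W Wo G Gs GT Gu).
Implicit Types (x u v w : vec) (X Y Z : svec).

Definition eval_at (p : {x | W x}) : {rmorphism smooth_fun Wo -> R} :=
  @smooth_eval _ _ _ Wo _ (svalP p).

Lemma eval_at_inj (f h : smooth_fun Wo) : (forall p, eval_at p f =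
  eval_at p h) -> f = h.
Proof. by move=> e; apply: smooth_fun_eq => x Wx;
  exact: (e (exist _ x Wx)). Qed.

Lemma eval_at_cst p a : eval_at p (cst_smooth Wo a) = a.
Proof. exact: (smooth_ofE _ _ (svalP p)). Qed.

Lemma evalv_rep (Z : vec -> vec) X (p : {x | W x}) : rep Z X ->
  evalv eval_at p X = Z (sval p).
Proof. by move=> r; apply/rowP => k; rewrite mxE (r _ _ (svalP p)). Qed.

Lemma rep_evalv X : rep (fun x => \row_k X 0 k x) X.
Proof. by move=> x k Wx; rewrite mxE. Qed.

Lemma eval_at_gm p X Y :
  eval_at p (metric C X Y) = mdot (G (sval p)) (evalv eval_at p X) (evalv
    eval_at p Y).
Proof.
have e := rep_metric Gs GT Gu (rep_evalv X) (rep_evalv Y) (svalP p).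
by rewrite (evalv_rep p (rep_evalv X)) (evalv_rep p (rep_evalv Y)) e.
Qed.

Lemma act_derive (Z : vec -> vec) X (f : smooth_fun Wo) x : rep Z X -> W x ->
  act C X f x = 'D_(Z x) f x.
Proof.
move=> r Wx; have [_ ->] := smooth_derive Wo (Z x) (smooth_valP f) Wx.
rewrite [act _ _ _]/= /dact smooth_fun_sum//; apply: eq_bigr => i _.
by rewrite smooth_funM// partialE// r.
Qed.

Lemma act_cst_smooth X a : act C X (cst_smooth Wo a) = 0.
Proof.
apply: smooth_fun_eq => x Wx; rewrite smooth_fun0 (act_derive _ (@rep_evalv X)
  Wx).
rewrite -[RHS](derive_cst a x (\row_k X 0 k x)).
by apply: (derive_eqW Wo) => // y Wy; rewrite smooth_ofE.
Qed.

Lemma nabla_parallel (V : vec -> vec) VS : rep V VS ->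
  (forall x u, W x -> levi_civita G (cst u) V x = 0) ->
    forall X, nabla C X VS = 0.
Proof.
move=> rV Vp X; rewrite [X]row_sum_delta.
rewrite (big_morph (nabla C ^~ VS) (id1 := 0) (op1 := +%R)); last 2 first.
- by move=> Y Z; exact: nablaDl.
- exact: nabla0l.
rewrite big1// => i _; rewrite nablaZl.
suff -> : nabla C (delta_mx 0 i) VS = 0 by rewrite scaler0.
have -> : delta_mx 0 i = cst_field Wo (delta_mx 0 i).
  apply/rowP => j; apply: smooth_fun_eq => x Wx; rewrite !mxE smooth_ofE// /cst.
  by case: (_ && _); rewrite ?smooth_fun1// smooth_fun0.
apply/rowP => k; apply: smooth_fun_eq => x Wx.
rewrite -(rep_nabla Gs GT Gu (rep_cst Wo (basis_vec i)) rV k Wx) (Vp _ _ Wx).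
by rewrite !mxE smooth_fun0.
Qed.

(** By [killing_lie] the Lie derivative of the metric on constant fields is the left-hand side of
    the Killing equation, which is tensorial. *)
Lemma killing_onP (K : vec -> vec) KS : rep K KS -> killing_on W G K ->
  killing C KS.
Proof.
move=> rK kK; apply: (killing_of_cst eval_at_inj eval_at_cst eval_at_gm) => u v.
rewrite -killing_lie; apply: smooth_fun_eq => x Wx; rewrite smooth_fun0.
rewrite -(kK x Wx u v) /lie_metric.
have e1 := act_derive (metric C (cst_field Wo u) (cst_field Wo v)) rK Wx.
have e2 := rep_metric Gs GT Gu (rep_br Gs GT Gu rK (rep_cst Wo u)) (rep_cst Wo
  v) Wx.
have e3 := rep_metric Gs GT Gu (rep_cst Wo u) (rep_br Gs GT Gu rK (rep_cst Wo
  v)) Wx.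
rewrite e2 e3 {e2 e3}.
apply: etrans (smooth_funD _ _ Wx) _; rewrite (smooth_funN _ Wx).
congr (_ - _); apply: etrans (smooth_funD _ _ Wx) _; rewrite (smooth_funN _ Wx).
congr (_ - _); apply: etrans e1 _; apply: (derive_eqW Wo) => // y Wy.
by rewrite -(rep_metric Gs GT Gu (rep_cst Wo u) (rep_cst Wo v) Wy).
Qed.

Local Notation Rmp := (curv_at C eval_at (cst_smooth Wo)).

Lemma riemE (p : {x | W x}) u v w : riem G (sval p) u v w = Rmp p u v w.
Proof.
apply: esym; apply: (@evalv_rep (curvature G (cst u) (cst v) (cst w))).
exact: (rep_curv Gs GT Gu (rep_cst Wo u) (rep_cst Wo v) (rep_cst Wo w)).
Qed.

(** On a decomposable bivector the endomorphism is the matrix of R(u, v) multiplied by the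
    invertible [invmx (G x)], so both vanish together. *)
Lemma curvature_endo_wedge (p : {x | W x}) u v w :
  curvature_endo G (sval p) (wedge u v) = 0 -> Rmp p u v w = 0.
Proof.
have l1 a u1 u2 v1 w1 :
    Rmp p (a *: u1 + u2) v1 w1 = a *: Rmp p u1 v1 w1 + Rmp p u2 v1 w1.
  by apply: curv_at_lin1; exact: eval_at_cst.
have l3 a u1 v1 w1 w2 :
    Rmp p u1 v1 (a *: w1 + w2) = a *: Rmp p u1 v1 w1 + Rmp p u1 v1 w2.
  by apply: curv_at_lin3; exact: eval_at_cst.
have lC u1 v1 w1 : Rmp p u1 v1 w1 = - Rmp p v1 u1 w1 by exact: curv_atC.
have -> : curvature_endo G (sval p) (wedge u v) =
    invmx (G (sval p)) *m op_mx (Rmp p) u v.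
  have two : 2%:R != 0 :> R by rewrite pnatr_eq0.
  apply: etrans _ (wedge_sum l1 lC u v (invmx (G (sval p))) two).
  congr (_ *: _); apply: eq_bigr => i _; apply: eq_bigr => j _.
  congr (_ *: _); first by rewrite /wedge !mxE !big_ord1 !mxE.
  congr (_ *m _); apply/matrixP => m k; rewrite [LHS]mxE [RHS]mxE.
  by have -> := riemE p (basis_vec i) (basis_vec j) (basis_vec m).
move=> e; have {}e : op_mx (Rmp p) u v = 0.
  by rewrite -[op_mx _ u v](mulKVmx (Gu (svalP p))) e mulmx0.
by rewrite (op_mxE l3 u v w) e mulmx0.
Qed.

Context (V : vec -> vec) (Kf : set (vec -> vec)).
Hypothesis V_smooth : smooth_map W V.
Hypothesis V_neq0 : forall x, W x -> V x != 0.
Hypothesis V_null : forall x, W x -> mdot (G x) (V x) (V x) = 0.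
Hypothesis V_parallel : forall x u, W x -> levi_civita G (cst u) V x = 0.
Hypothesis G_lorentz : forall x, W x -> lorentz_form (G x).
Hypothesis V_curv : forall x u v, W x -> mdot (G x) u (V x) = 0 ->
  mdot (G x) v (V x) = 0 -> curvature_endo G x (wedge u v) = 0.
Hypothesis Kf_smooth : forall K, Kf K -> smooth_map W K.
Hypothesis Kf_killing : forall K, Kf K -> killing_on W G K.
Hypothesis Kf_perp : forall K x, Kf K -> W x -> mdot (G x) (K x) (V x) = 0.
Hypothesis Kf_span : forall x w, W x -> mdot (G x) w (V x) = 0 ->
  exists m (K : 'I_m -> vec -> vec),
    (forall i, Kf (K i)) /\ (w <= \matrix_i K i x)%MS.

Lemma chart_nabla_riem_eq0 x s u v w : W x -> mdot (G x) s (V x) = 0 ->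
  nabla_riem G x s u v w = 0.
Proof.
move=> Wx ps; pose p : {x | W x} := exist _ x Wx.
pose VS := smooth_field Wo V_smooth; have rV : rep V VS by exact: rep_field.
have evV q : evalv eval_at q VS = V (sval q) by exact: evalv_rep.
have -> : nabla_riem G x s u v w =
    evalv eval_at p (nabla_curv C (cst_field Wo s) (cst_field Wo u) (cst_field
      Wo v) (cst_field Wo w)).
  apply: esym; apply: (@evalv_rep (nabla_curvature G (cst s) (cst u) (cst v)
    (cst w))).
  exact: (rep_nabla_curv Gs GT Gu (rep_cst Wo s) (rep_cst Wo u) (rep_cst Wo v)
    (rep_cst Wo w)).
apply: (nabla_curv_perp_eq0 eval_at_inj eval_at_cst act_cst_smooth eval_at_gm
  (fun q => Gu (svalP q))
  (VS := VS)).
- exact: nabla_parallel rV V_parallel.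
- by apply: eval_at_inj => q; rewrite eval_at_gm !evV V_null ?rmorph0//;
  exact: svalP.
- move=> q u1 v1 w1; rewrite evV => pu pv; apply: curvature_endo_wedge.
  by apply: V_curv => //; exact: svalP.
- exact: G_lorentz.
- by rewrite evV V_neq0.
- move=> u1; rewrite evV => /(Kf_span Wx)[m [K [KK uK]]].
  exists m, (fun i => smooth_field Wo (Kf_smooth (KK i))); split=> [i|].
    split.
      by apply: (killing_onP (K := K i)); [exact: rep_field | exact:
        Kf_killing].
    have rK : rep (K i) (smooth_field Wo (Kf_smooth (KK i))) by exact:
      rep_field.
    apply: eval_at_inj => q; rewrite eval_at_gm evV (evalv_rep q rK) rmorph0.
    by apply: Kf_perp => //; exact: svalP.
  suff -> : \matrix_i evalv eval_at p (smooth_field Wo (Kf_smooth (KK i))) =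
    \matrix_i K i x by [].
  apply/row_matrixP => i; rewrite !rowK.
  by apply: (evalv_rep (Z := K i) p); exact: rep_field.
- by rewrite evV.
Qed.

End Chart.

Section Charts.
Context (R : realType) (n : nat) (T : topologicalType) (c : chart R n T).

Lemma cimageS (U U' : set T) : U `<=` U' -> cimage c U `<=` cimage c U'.
Proof. by move=> UU' _ [p [cp Up] <-]; exists p => //; split=> //;
  exact: UU'. Qed.

(** Inside the open range of the chart, the image of [U] is its preimage under the continuous
    [cinv]. *)
Lemma open_cimage (U : set T) : open U -> open (cimage c U).
Proof.
move=> Uo; rewrite openE => _ [p [cp Up] <-].
have rp : (cmap c @` cdom c) (cmap c p) by exists p.
have Ur : nbhs (cmap c p) (cinv c @^-1` U).
  by apply: (cinv_continuous rp); rewrite cmapK//; exact: open_nbhs_nbhs.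
have rr : nbhs (cmap c p) (cmap c @` cdom c).
  by apply: open_nbhs_nbhs; split=> //; exact: crange_open.
apply: filterS (filterI rr Ur) => _ [[q cq <-]] /=; rewrite cmapK// => Uq.
by exists q.
Qed.

End Charts.

Theorem theorem2 (R : realType) (n : nat) (M : manifold R n)
  (g : bilinear_field M) (V : vfield M)
  (g_lorentzian : lorentzian_metric g)
  (g_indecomposable : strongly_indecomposable g)
  (g_pp_wave : pp_wave g V)
  (g_killing : forall p : M, exists (U : set M) (S : set (vfield M)),
    [/\ open U, U p, (forall K, S K -> killing_field_on g U K)
      & spans_orthogonal g V U S]) :
  plane_wave g V.
Proof.
split=> // c _ s ac [p [cp _] <-] sV u v w.
have [U [S [Uo Up SK Ssp]]] := g_killing p.
have [g_semi g_lor _] := g_lorentzian.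
have [[[V_smooth _] V_par] _ V_curv] := g_pp_wave.
have [_ g_smooth g_sym] := g_semi c ac.
have sub : cimage c U `<=` cimage c setT by exact: cimageS.
have Wp : cimage c U (cmap c p) by exists p.
pose Kf := [set K' : 'rV[R]_n -> 'rV[R]_n | exists2 K, S K & K' = K c].
(* The coordinate domain is the image of [U], not of the whole chart, because the Killing fields are
   given on [U] only. *)
apply: (@chart_nabla_riem_eq0 R n (cimage c U) (open_cimage Uo) (g c)
  _ _ _ (V c) Kf) => //.
- by move=> i j t x /sub Wx; exact: g_smooth.
- by move=> x /sub /g_sym[].
- by move=> x /sub /g_sym[].
- by move=> j t x /sub Wx; exact: (V_smooth c ac).
- by move=> x /sub /(V_par c _ ac)[].
- by move=> x /sub /(V_par c _ ac)[].
- by move=> x u' /sub /(V_par c _ ac)[].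
- by move=> x /sub /(g_lor c _ ac).
- by move=> x u' v' /sub Wx; exact: V_curv.
- by move=> _ [K SKK ->]; have [[+ _] _] := SK _ SKK; exact.
- by move=> _ [K SKK ->]; have [_] := SK _ SKK; exact.
- move=> _ x [K SKK ->] Wx; apply/(Ssp c x _ ac Wx).
  (* As a family with one member, [K] has its own value in its span, hence in the orthogonal of
     V. *)
  exists 1%N, (fun=> K); split=> //.
  have -> : \matrix_(i < 1) K c x = K c x by apply/rowP => j; rewrite mxE.
  exact: submx_refl.
- move=> x w' Wx /(Ssp c x _ ac Wx)[m [K [SK' wK]]].
  by exists m, (fun i => K i c); split=> // i; exists (K i).
Qed.
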